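(* Let $n\geq 2$ be an integer and let $1\leq p<\infty$. Then the $p$-Wasserstein torus $\mathcal{W}_p(\mathbb{T}^n)$ is isometrically rigid, that is, the push-forward operation $\#\colon \mathrm{Isom}(\mathbb{T}^n)\to \mathrm{Isom}(\mathcal{W}_p(\mathbb{T}^n))$, $\psi\mapsto\psi_\#$, is surjective: for every isometry $\Phi\colon\mathcal{W}_p(\mathbb{T}^n)\to\mathcal{W}_p(\mathbb{T}^n)$ there exists an isometry $\psi\colon\mathbb{T}^n\to\mathbb{T}^n$ such that $\Phi(\mu)=\psi_\#\mu$ for all $\mu\in\mathcal{W}_p(\mathbb{T}^n)$.
   Context: The $n$-dimensional torus is $\mathbb{T}^n=\mathbb{R}^n/\mathbb{Z}^n\simeq[-1/2,1/2)^n$ with the metric $\varrho(x,y)=\left(\sum_{k=1}^n |(x_k-y_k)_{\mathrm{mod}\ 1}|^2\right)^{1/2}$, where $(t)_{\mathrm{mod}\ 1}$ denotes the representative of $t$ modulo $1$ in $[-1/2,1/2)$ (so $|(t)_{\mathrm{mod}\ 1}|$ is the distance of $t$ to the nearest integer). For a complete separable metric space $(X,r)$ and $1\le p<\infty$, the $p$-Wasserstein space $\mathcal{W}_p(X)$ is the set of all Borel probability measures $\mu$ on $X$ with $\int_X r(x,\hat x)^p\,\mathrm{d}\mu(x)<\infty$ for all $\hat x\in X$ (for compact $X$, this is all Borel probability measures), endowed with the distance $$d_{\mathcal{W}_p}(\mu,\nu)=\left(\inf_{\pi\in\Pi(\mu,\nu)}\int_{X\times X} r(x,y)^p\,\mathrm{d}\pi(x,y)\right)^{1/p},$$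 where $\Pi(\mu,\nu)$ is the set of Borel probability measures $\pi$ on $X\times X$ (couplings) with $\pi(A\times X)=\mu(A)$ and $\pi(X\times B)=\nu(B)$ for all Borel $A,B\subseteq X$. An isometry is a distance-preserving bijection of a metric space onto itself, and $\mathrm{Isom}(\cdot)$ denotes the isometry group. For $\psi\in\mathrm{Isom}(X)$, the push-forward $\psi_\#\colon\mathcal{W}_p(X)\to\mathcal{W}_p(X)$ is $(\psi_\#\mu)(A)=\mu(\psi^{-1}[A])$ for Borel $A\subseteq X$; it is an isometry of $\mathcal{W}_p(X)$. The space $\mathcal{W}_p(X)$ is called isometrically rigid if $\psi\mapsto\psi_\#$ is surjective onto $\mathrm{Isom}(\mathcal{W}_p(X))$. Here $\mathcal{W}_p(\mathbb{T}^n)$ is the $p$-Wasserstein space over $(\mathbb{T}^n,\varrho)$. *)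

(* Defs.v *)
From HB Require Import structures.
From mathcomp Require Import all_boot all_order all_algebra.
From mathcomp Require Import all_classical all_reals all_analysis.
From mathcomp Require Import ring lra zify.

Set Implicit Arguments.
Unset Strict Implicit.
Unset Printing Implicit Defensive.

Import Order.TTheory GRing.Theory Num.Theory.
Import numFieldNormedType.Exports.

Local Open Scope classical_set_scope.
Local Open Scope ring_scope.

(* [g_sigma_algebraType] requires a pointed carrier. *)
#[short(type="pmetricType")]
HB.structure Definition PointedMetric (K : numDomainType) :=
  {M of Metric K M & isPointed M}.

HB.instance Definition _ (T U : ptopologicalType) := Pointed.on (T * U)%type.

Definition borel (T : ptopologicalType) := g_sigma_algebraType (@open T).

HB.instance Definition _ (T : ptopologicalType) := Measurable.on (borel T).

Definition is_isometry {T D : Type} (d : T -> T -> D) (f : T -> T) : Prop :=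
  bijective f /\ (forall x y, d (f x) (f y) = d x y).

Lemma probability_eq d (T : measurableType d) (R : realType)
    (m1 m2 : probability T R) : m1 = m2 :> (set T -> \bar R) -> m1 = m2.
Proof.
case: m1 m2 => [f +] [g +] /= fg; rewrite {}fg.
case=> -[a1 a2] [a3] [a4] [a5] [a6] [a7] [a8].
case=> -[b1 b2] [b3] [b4] [b5] [b6] [b7] [b8].
by rewrite (Prop_irrelevance a1 b1) (Prop_irrelevance a2 b2)
  (Prop_irrelevance a3 b3) (Prop_irrelevance a4 b4) (Prop_irrelevance a5 b5)
  (Prop_irrelevance a6 b6) (Prop_irrelevance a7 b7) (Prop_irrelevance a8 b8).
Qed.

Section wasserstein.
Context {R : realType}.

(* A [probability] of the library is a function on all sets that is only
   constrained on the measurable ones, so distinct terms may denote the same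
   measure. Requiring the value 0 on nonmeasurable sets selects exactly one
   representative of every Borel probability measure: see [wasserstein_eq] and
   [to_wasserstein]. *)
Record wasserstein (X : pmetricType R) (p : R) := Wasserstein {
  wmeasure :> probability (borel X) R ;
  wmeasure_moment : forall x0 : X,
    (\int[wmeasure]_(x in [set: borel X]) (mdist (x : X) x0 `^ p)%:E < +oo)%E ;
  wmeasure_out : forall A : set (borel X), ~ measurable A -> wmeasure A = 0%E
}.

Variables (X : pmetricType R) (p : R).

Lemma wasserstein_eq (mu nu : wasserstein X p) :
  (forall A : set (borel X), measurable A -> mu A = nu A) -> mu = nu.
Proof.
case: mu nu => [mu mum muo] [nu num nuo] /= munu.
have E : mu = nu.
  apply: probability_eq; apply/funext => A.
  have [mA|nA] := pselect (measurable A); first exact: munu.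
  by rewrite muo// nuo.
move: mum muo {munu}; rewrite {}E => mum muo.
by rewrite (Prop_irrelevance mum num) (Prop_irrelevance muo nuo).
Qed.

Section to_wasserstein.
Variable P : probability (borel X) R.
Hypothesis Pm : forall x0 : X,
  (\int[P]_(x in [set: borel X]) (mdist (x : X) x0 `^ p)%:E < +oo)%E.

Definition borel_part (A : set (borel X)) : \bar R :=
  if pselect (measurable A) then P A else 0%E.

Let borel_partE A : measurable A -> borel_part A = P A.
Proof. by rewrite /borel_part; case: pselect. Qed.

Let borel_part0 : borel_part set0 = 0%E.
Proof. by rewrite borel_partE// measure0. Qed.

Let borel_part_ge0 A : (0 <= borel_part A)%E.
Proof. by rewrite /borel_part; case: pselect => ?; rewrite ?measure_ge0. Qed.

Let borel_part_sigma_additive : semi_sigma_additive borel_part.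
Proof.
move=> F mF tF mUF; rewrite borel_partE//.
have -> : (fun n => \sum_(0 <= i < n) borel_part (F i))%E
        = (fun n => \sum_(0 <= i < n) P (F i))%E.
  by apply/funext => n; apply: eq_bigr => i _; rewrite borel_partE.
exact: measure_semi_sigma_additive.
Qed.

HB.instance Definition _ := isMeasure.Build _ _ _ borel_part
  borel_part0 borel_part_ge0 borel_part_sigma_additive.

Let borel_part_setT : borel_part [set: borel X] = 1%E.
Proof. by rewrite borel_partE// probability_setT. Qed.

HB.instance Definition _ :=
  Measure_isProbability.Build _ _ _ borel_part borel_part_setT.

Let borel_part_moment (x0 : X) :
  (\int[borel_part]_(x in [set: borel X]) (mdist (x : X) x0 `^ p)%:E < +oo)%E.
Proof.
rewrite (eq_measure_integral P)// => A mA _; exact: borel_partE.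
Qed.

Let borel_part_out A : ~ measurable A -> borel_part A = 0%E.
Proof. by rewrite /borel_part; case: pselect. Qed.

Definition to_wasserstein : wasserstein X p :=
  Wasserstein borel_part_moment borel_part_out.

Lemma to_wassersteinE A : measurable A -> to_wasserstein A = P A.
Proof. exact: borel_partE. Qed.

End to_wasserstein.

Definition coupling (mu nu : wasserstein X p) :
    set (probability (borel (X * X)%type) R) :=
  [set pi | (forall A : set (borel X), measurable A -> pi (A `*` setT) = mu A) /\
            (forall B : set (borel X), measurable B -> pi (setT `*` B) = nu B)].

Definition wdist (mu nu : wasserstein X p) : \bar R :=
  (ereal_inf
     [set \int[pi]_(z in [set: borel (X * X)%type])
            (mdist (z.1 : X) (z.2 : X) `^ p)%:E
     | pi in coupling mu nu] `^ p^-1)%E.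

Definition isometrically_rigid : Prop :=
  forall Phi : wasserstein X p -> wasserstein X p, is_isometry wdist Phi ->
  exists2 psi : X -> X, is_isometry (@mdist R X) psi &
    forall (mu : wasserstein X p) (A : set (borel X)), measurable A ->
      Phi mu A = pushforward mu (psi : borel X -> borel X) A.

End wasserstein.

(* A point of R^n / Z^n is given by its representative in [-1/2, 1/2)^n. *)
Record torus (R : realType) (n : nat) := Torus {
  torus_val :> 'rV[R]_n ;
  _ : [forall i, torus_val 0 i \in `[- 2^-1, 2^-1[ ] }.

HB.instance Definition _ R n := [isSub for @torus_val R n].
HB.instance Definition _ R n := [Choice of torus R n by <:].

Section torus_metric.
Context {R : realType}.

Definition mod1 (t : R) : R := t - (Num.floor (t + 2^-1))%:~R.

Definition torus_dist n (x y : torus R n) : R :=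
  Num.sqrt (\sum_(k < n) `|mod1 (x 0 k - y 0 k)| ^+ 2).

Lemma mod1_itv t : mod1 t \in `[- 2^-1, 2^-1[.
Proof.
rewrite in_itv/= /mod1; have /andP[] := floor_itv (t + 2^-1).
by rewrite intrD => h1 h2; apply/andP; split; lra.
Qed.

Lemma mod1_min t (k : int) : `|mod1 t| <= `|t - k%:~R|.
Proof.
have := mod1_itv t; rewrite in_itv/= => /andP[h1 h2].
have -> : t - k%:~R = mod1 t + (Num.floor (t + 2^-1) - k)%:~R.
  by rewrite /mod1 intrB; ring.
have [->|m0] := eqVneq (Num.floor (t + 2^-1) - k) 0; first by rewrite addr0.
set m := _ - k in m0 *; have m1 : 1 <= `|m%:~R : R|.
  by rewrite -intr_norm (_ : 1 = 1%:~R)// ler_int -gtz0_ge1 normr_gt0.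
have ht : `|mod1 t| <= 2^-1 by rewrite ler_norml h1/= ltW.
have := lerB_normD (m%:~R : R) (mod1 t); rewrite [_ + mod1 t]addrC; lra.
Qed.

Lemma mod1N t : `|mod1 (- t)| = `|mod1 t|.
Proof.
have mle u : `|mod1 (- u)| <= `|mod1 u|.
  apply: le_trans (mod1_min _ (- Num.floor (u + 2^-1))) _.
  by rewrite intrN -opprD normrN.
by apply/eqP; rewrite eq_le mle -{1}(opprK t) mle.
Qed.

Lemma mod1D s t : `|mod1 (s + t)| <= `|mod1 s| + `|mod1 t|.
Proof.
apply: le_trans (mod1_min _ (Num.floor (s + 2^-1) + Num.floor (t + 2^-1))) _.
by rewrite intrD opprD addrACA ler_normD.
Qed.

Lemma sqrt_sumsq_triangle n (a b c : 'I_n -> R) :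
    (forall i, 0 <= a i) -> (forall i, 0 <= b i) -> (forall i, 0 <= c i) ->
    (forall i, c i <= a i + b i) ->
  Num.sqrt (\sum_i c i ^+ 2) <=
  Num.sqrt (\sum_i a i ^+ 2) + Num.sqrt (\sum_i b i ^+ 2).
Proof.
move=> a0 b0 c0 cab.
set A := \sum_i a i ^+ 2; set B := \sum_i b i ^+ 2.
set S := \sum_i a i * b i.
have A0 : 0 <= A by apply: sumr_ge0 => i _; exact: sqr_ge0.
have B0 : 0 <= B by apply: sumr_ge0 => i _; exact: sqr_ge0.
have S0 : 0 <= S by apply: sumr_ge0 => i _; exact: mulr_ge0.
have quad u : 0 <= A - 2 * u * S + u ^+ 2 * B.
  have -> : A - 2 * u * S + u ^+ 2 * B = \sum_i (a i - u * b i) ^+ 2.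
    rewrite /A /S /B !mulr_sumr -sumrB -big_split/=.
    by apply: eq_bigr => i _; ring.
  by apply: sumr_ge0 => i _; exact: sqr_ge0.
have SAB : S ^+ 2 <= A * B.
  have [BE|Bn] := eqVneq B 0.
    have [SE|Sn] := eqVneq S 0; first by rewrite SE BE expr0n/= mulr0.
    have := quad ((A + 1) / (2 * S)); rewrite BE mulr0 addr0.
    have -> : 2 * ((A + 1) / (2 * S)) * S = A + 1 by field.
    lra.
  have Bp : 0 < B by rewrite lt_neqAle eq_sym Bn.
  have := quad (S / B).
  have -> : A - 2 * (S / B) * S + (S / B) ^+ 2 * B = (A * B - S ^+ 2) / B.
    by field.
  by rewrite pmulr_lge0 ?invr_gt0// subr_ge0.
have Sle : S <= Num.sqrt A * Num.sqrt B.
  by rewrite -sqrtrM// -(ger0_norm S0) -sqrtr_sqr ler_sqrt// mulr_ge0.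
rewrite -[leRHS]ger0_norm ?addr_ge0 ?sqrtr_ge0// -sqrtr_sqr ler_sqrt ?sqr_ge0//.
rewrite sqrrD !sqr_sqrtr//.
apply: (@le_trans _ _ (A + S *+ 2 + B)); last by rewrite lerD2r lerD2l ler_wMn2r.
rewrite -sumrMnl -!big_split/=; apply: ler_sum => i _.
by rewrite -sqrrD lerXn2r// ?nnegrE// addr_ge0.
Qed.

Section instance.
Variable n : nat.
Implicit Types x y z : torus R n.

Lemma torus_distxx x : torus_dist x x = 0.
Proof.
rewrite /torus_dist big1 ?sqrtr0// => i _.
suff /eqP -> : `|mod1 (x 0 i - x 0 i)| == 0 by rewrite expr0n.
rewrite eq_le normr_ge0 andbT (le_trans (mod1_min _ 0))//.
by rewrite subrr subr0 normr0.
Qed.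

Lemma torus_dist_eq0 x y : torus_dist x y = 0 -> x = y.
Proof.
move/eqP; rewrite sqrtr_eq0 => le0; apply: val_inj => /=; apply/rowP => i.
have /eqP : \sum_(k < n) `|mod1 (x 0 k - y 0 k)| ^+ 2 = 0.
  by apply/eqP; rewrite eq_le le0 sumr_ge0// => k _; exact: sqr_ge0.
rewrite psumr_eq0 => [/allP/(_ i)|k _]; last exact: sqr_ge0.
rewrite mem_index_enum expf_eq0/= normr_eq0 => /(_ isT)/eqP.
rewrite /mod1; set m := Num.floor _ => /eqP; rewrite subr_eq0 => /eqP xym.
have tor z : - 2^-1 <= z 0 i < 2^-1.
  by case: z => v /= /forallP/(_ i); rewrite in_itv.
have /andP[x1 x2] := tor x; have /andP[y1 y2] := tor y.
have m1 : (-1)%:~R < (m%:~R : R) by rewrite -xym intrN; lra.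
have m2 : (m%:~R : R) < 1%:~R by rewrite -xym; lra.
move: m1 m2; rewrite !ltr_int => m1 m2.
have m0 : m = 0 by lia.
by move: xym; rewrite m0 => /eqP; rewrite subr_eq0 => /eqP.
Qed.

Lemma torus_dist_sym x y : torus_dist x y = torus_dist y x.
Proof.
by congr Num.sqrt; apply: eq_bigr => i _; rewrite -mod1N opprB.
Qed.

Lemma torus_dist_triangle y x z :
  torus_dist x z <= torus_dist x y + torus_dist y z.
Proof.
apply: sqrt_sumsq_triangle => // i; apply: le_trans (mod1D _ _).
by rewrite addrA subrK.
Qed.

HB.instance Definition _ := isMetric.Build R (torus R n)
  torus_distxx torus_dist_eq0 torus_dist_sym torus_dist_triangle.

Fact torus0_subproof : [forall i, (0 : 'rV[R]_n) 0 i \in `[- 2^-1, 2^-1[ ].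
Proof. by apply/forallP => i; rewrite mxE in_itv/=; apply/andP; split; lra. Qed.

HB.instance Definition _ := isPointed.Build (torus R n) (Torus torus0_subproof).

End instance.
End torus_metric.

(* Main.v *)
Require Import Defs.
From HB Require Import structures.
From mathcomp Require Import all_boot all_order all_algebra.
From mathcomp Require Import all_classical all_reals all_analysis measurable_realfun.
From mathcomp Require Import ring lra.

(** The diameter of the torus is attained exactly at pairs of antipodal points
    (half-shifts of each other in every coordinate). If two measures are at
    distance the diameter, already the product coupling forces both to be Dirac
    masses; hence an isometry [Phi] of the Wasserstein space permutes the Dirac
    masses, and after composing with a push-forward it fixes all of them. It then
    preserves the potentials [y |-> \int d(y, z)^p dmu(z)].

    Let [a <> b] be such that [z |-> d(a, z)^p - d(b, z)^p] has a strict minimum at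
    [z0]. The distances from [mu] to the measures [l delta_a + (1 - l) delta_b]
    determine the mass of [mu] at [z0]. So if [Phi] fixes these measures for
    almost all [l], and [z0] can be any point, then [Phi] fixes finitely supported
    measures, and by density it is the identity.

    For [p < 2], [a = z0] and [b] is the half-shift of [z0] in one coordinate; for
    [p >= 2], [a = z0] and [b] is its antipode. If [p <> 2] the mixtures
    [l delta_a + (1 - l) delta_b] are determined by their potentials, because
    [z |-> d(a', z)^p + d(b', z)^p] is maximal exactly at [a] and [b] for suitable
    [a'] and [b']. If [p = 2] the
    potentials only determine the coordinate marginals, which live on the cube of
    all half-shifts of [a]. Let [nu] be the mixture of [a] and its antipode, with
    [l < 1/2], and [om] the mixture [l delta_(e_j) + (1 - l) delta_(e_i)] of the
    half-shifts of [a] in one coordinate: every coupling of [nu] and [om] has the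
    same cost, while [Phi nu] and [Phi om] admit a strictly cheaper coupling as
    soon as the coordinates of [Phi nu] differ with positive probability. *)

Set Implicit Arguments.
Unset Strict Implicit.
Unset Printing Implicit Defensive.

Import Order.TTheory GRing.Theory Num.Theory.
Import numFieldNormedType.Exports.

Local Open Scope classical_set_scope.
Local Open Scope ring_scope.

(** * Integrals of bounded functions *)

Section bounded_integrals.
Context d {T : measurableType d} {R : realType}.
Implicit Types (P : probability T R) (f g : T -> R) (A B S : set T).

(** Such functions are integrable against every probability, so integrals can be handled as real
    numbers without further side conditions. On a space of finite diameter the transport costs are
    of this kind. *)
Definition bmeas f := measurable_fun setT f /\ exists M : R, forall x, `|f x| <= M.

Definition pr P A : R := fine (P A).

Lemma bmeas_cst (r : R) : bmeas (fun=> r).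
Proof. by split; [exact: measurable_cst|exists `|r|]. Qed.

Lemma bmeasD f g : bmeas f -> bmeas g -> bmeas (fun x => f x + g x).
Proof.
move=> [mf [M fM]] [mg [N gN]]; split; first exact: measurable_funD.
by exists (M + N) => x; rewrite (le_trans (ler_normD _ _))// lerD.
Qed.

Lemma bmeasZ (r : R) f : bmeas f -> bmeas (fun x => r * f x).
Proof.
move=> [mf [M fM]]; split; first exact: measurable_funM.
by exists (`|r| * M) => x; rewrite normrM ler_wpM2l.
Qed.

Lemma bmeasN f : bmeas f -> bmeas (fun x => - f x).
Proof.
move=> bf; rewrite (_ : (fun x => _) = (fun x => -1 * f x)); first exact: bmeasZ.
by apply/funext => x; rewrite mulN1r.
Qed.

Lemma bmeasB f g : bmeas f -> bmeas g -> bmeas (fun x => f x - g x).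
Proof. by move=> bf bg; apply: bmeasD => //; exact: bmeasN. Qed.

Lemma bmeas_indic A : measurable A -> bmeas (\1_A : T -> R).
Proof.
move=> mA; split; first exact: measurable_indic.
by exists 1 => x; rewrite indicE; case: (_ \in _); rewrite ?normr1 ?normr0.
Qed.

Lemma bmeas_min f g : bmeas f -> bmeas g -> bmeas (fun x => Num.min (f x) (g x)).
Proof.
move=> [mf [M fM]] [mg [N gN]]; split; first exact: measurable_minr.
exists (M + N) => x; have := fM x; have := gN x.
have := normr_ge0 (f x); have := normr_ge0 (g x).
by rewrite /Num.min; case: ifP => _; lra.
Qed.

Lemma bmeas_integrable P f : bmeas f -> P.-integrable setT (EFin \o f).
Proof.
move=> [mf [M fM]]; apply: measurable_bounded_integrable => //.
  by rewrite -ge0_fin_numE// fin_num_measure.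
exists M; split; first exact: num_real.
by move=> x Mx y _ /=; rewrite (le_trans (fM _))// ltW.
Qed.

Lemma EFin_Rint P f : bmeas f -> (\int[P]_x f x)%:E = (\int[P]_x (f x)%:E)%E.
Proof.
by move=> bf; rewrite /Rintegral fineK// integrable_fin_num//; exact: bmeas_integrable.
Qed.

Lemma RintD P f g : bmeas f -> bmeas g ->
  \int[P]_x (f x + g x) = \int[P]_x f x + \int[P]_x g x.
Proof. by move=> bf bg; apply: RintegralD => //; exact: bmeas_integrable. Qed.

Lemma RintB P f g : bmeas f -> bmeas g ->
  \int[P]_x (f x - g x) = \int[P]_x f x - \int[P]_x g x.
Proof. by move=> bf bg; apply: RintegralB => //; exact: bmeas_integrable. Qed.

Lemma RintZ P (r : R) f : bmeas f ->
  \int[P]_x (r * f x) = r * \int[P]_x f x.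
Proof. by move=> bf; apply: RintegralZl => //; exact: bmeas_integrable. Qed.

Lemma Rint_indic P A : measurable A -> \int[P]_x (\1_A x : R) = pr P A.
Proof. by move=> mA; rewrite /Rintegral integral_indic// setIT. Qed.

Lemma EFin_pr P A : measurable A -> (pr P A)%:E = P A.
Proof. by move=> mA; rewrite fineK// fin_num_measure. Qed.

Lemma pr_ge0 P A : 0 <= pr P A.
Proof. exact: fine_ge0. Qed.

Lemma prT P : pr P setT = 1.
Proof. by rewrite /pr [P setT]probability_setT. Qed.

Lemma Rint_cst P (r : R) : \int[P]_x r = r.
Proof. by rewrite Rintegral_cst// -/(pr P setT) prT mulr1. Qed.

Lemma pr0 P : pr P set0 = 0.
Proof. by rewrite /pr measure0. Qed.

Lemma le_pr P A B : measurable A -> measurable B -> A `<=` B -> pr P A <= pr P B.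
Proof. by move=> mA mB AB; rewrite -lee_fin !EFin_pr// le_measure// inE. Qed.

Lemma pr_le1 P A : measurable A -> pr P A <= 1.
Proof. by move=> mA; rewrite -(prT P); exact: le_pr. Qed.

Lemma prU P A B : measurable A -> measurable B -> A `&` B = set0 ->
  pr P (A `|` B) = pr P A + pr P B.
Proof.
move=> mA mB AB; apply: EFin_inj; rewrite EFinD !EFin_pr//; last exact: measurableU.
by rewrite measureU.
Qed.

Lemma prC P A : measurable A -> pr P (~` A) = 1 - pr P A.
Proof.
move=> mA; rewrite -(prT P) -(setvU A) prU ?addrK//; first exact: measurableC.
by rewrite setICl.
Qed.

Lemma pr_split P A B : measurable A -> measurable B ->
  pr P A = pr P (A `&` B) + pr P (A `&` ~` B).
Proof.
move=> mA mB; rewrite -prU -?setIUr ?setUCr ?setIT//.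
- exact: measurableI.
- by apply: measurableI => //; exact: measurableC.
- by rewrite setIACA setICr setI0.
Qed.

Lemma pr_bigcup0 P (F : (set T)^nat) : (forall n, measurable (F n)) ->
  (forall n, pr P (F n) = 0) -> pr P (\bigcup_n F n) = 0.
Proof.
move=> mF F0; apply: EFin_inj; rewrite EFin_pr; last exact: bigcupT_measurable.
apply: measure_negligible; first exact: bigcupT_measurable.
apply: negligible_bigcup => n; apply/negligibleP => //.
by have := congr1 EFin (F0 n); rewrite EFin_pr.
Qed.

Lemma prI1 P A B : measurable A -> measurable B -> pr P B = 1 ->
  pr P (A `&` B) = pr P A.
Proof.
move=> mA mB B1; rewrite [RHS](pr_split _ _ mB)//.
suff -> : pr P (A `&` ~` B) = 0 by rewrite addr0.
have mCB : measurable (~` B) by exact: measurableC.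
have : pr P (A `&` ~` B) <= pr P (~` B).
  by by apply: le_pr => //; exact: measurableI.
rewrite prC// B1 subrr => ?; apply/eqP; rewrite eq_le pr_ge0 andbT//.
Qed.

(** Off the null complement of [S] the inequality is restored by adding to [g] a multiple of the
    indicator of that complement, which has integral zero. *)
Lemma le_Rint P S f g : measurable S -> pr P S = 1 -> bmeas f -> bmeas g ->
  (forall x, S x -> f x <= g x) -> \int[P]_x f x <= \int[P]_x g x.
Proof.
move=> mS S1 bf bg fg.
have [_ [M fM]] := bf; have [_ [N gN]] := bg.
have mCS : measurable (~` S) by exact: measurableC.
(* The constant [M + N] bounds [f x - g x] everywhere. *)
have bi := bmeasZ (M + N) (bmeas_indic mCS).
apply: (@le_trans _ _ (\int[P]_x (g x + (M + N) * \1_(~` S) x))).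
  apply: le_Rintegral => //; [exact: bmeas_integrable| |].
    by apply: bmeas_integrable; exact: bmeasD.
  move=> x _; rewrite indicE; have [Sx|nSx] := pselect (S x).
    by rewrite memNset ?mulr0 ?addr0 ?fg//; exact.
  rewrite mem_set// mulr1; have := fM x; have := gN x.
  by rewrite !ler_norml => /andP[? ?] /andP[? ?]; lra.
rewrite RintD// RintZ; last exact: bmeas_indic.
by rewrite Rint_indic// prC// S1 subrr mulr0 addr0.
Qed.

Lemma le_RintT P f g : bmeas f -> bmeas g ->
  (forall x, f x <= g x) -> \int[P]_x f x <= \int[P]_x g x.
Proof. by move=> bf bg fg; apply: (le_Rint measurableT) => //; exact: prT. Qed.

Lemma eq_Rint P S f g : measurable S -> pr P S = 1 -> bmeas f -> bmeas g ->
  (forall x, S x -> f x = g x) -> \int[P]_x f x = \int[P]_x g x.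
Proof.
move=> mS S1 bf bg fg.
by apply/eqP; rewrite eq_le !(@le_Rint _ S)// => x /fg ->.
Qed.

Lemma bmeas_sum (I : Type) (r : seq I) (K : pred I) (F : I -> T -> R) :
  (forall i, bmeas (F i)) -> bmeas (fun x => \sum_(i <- r | K i) F i x).
Proof.
move=> bF; elim: r => [|i r IH].
  by under eq_fun do rewrite big_nil; exact: bmeas_cst.
under eq_fun do rewrite big_cons.
by case: (K i) => //; exact: bmeasD.
Qed.

Lemma Rint_sum P (I : Type) (r : seq I) (K : pred I) (F : I -> T -> R) :
  (forall i, bmeas (F i)) -> \int[P]_x (\sum_(i <- r | K i) F i x) =
  \sum_(i <- r | K i) \int[P]_x F i x.
Proof.
move=> bF; elim: r => [|i r IH].
  by under eq_Rintegral do rewrite big_nil; rewrite Rint_cst big_nil.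
under eq_Rintegral do rewrite big_cons.
rewrite big_cons -IH; case: (K i) => //; rewrite RintD//; exact: bmeas_sum.
Qed.

(** By Markov's inequality each set where [f] is at least 1/(k+1) is null, and the set where [f] is
    positive is their countable union. *)
Lemma Rint_ge0_pr_gt0 P f : bmeas f -> (forall x, 0 <= f x) ->
  \int[P]_x f x <= 0 -> pr P [set x | 0 < f x] = 0.
Proof.
move=> bf f0 If.
have mfk k : measurable [set x | k.+1%:R^-1 <= f x].
  have mi : measurable (`[k.+1%:R^-1, +oo[%classic : set R) by exact: measurable_itv.
  by have := bf.1 measurableT _ mi; rewrite setTI set_itvE.
rewrite (_ : [set x | _] = \bigcup_k [set x | k.+1%:R^-1 <= f x]).
  apply: pr_bigcup0 => // k.
  have : \int[P]_x (k.+1%:R^-1 * \1_[set x | k.+1%:R^-1 <= f x] x) <= 0.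
    apply: le_trans If; apply: le_RintT => //.
      by apply: bmeasZ; exact: bmeas_indic.
    move=> x; rewrite indicE; have [h|h] := pselect ([set x | k.+1%:R^-1 <= f x] x).
      by rewrite mem_set// mulr1.
    by rewrite memNset// mulr0.
  rewrite RintZ; last exact: bmeas_indic.
  rewrite Rint_indic// pmulr_rle0 ?invr_gt0// => h.
  by apply/eqP; rewrite eq_le h pr_ge0.
apply/seteqP; split => x /= => [fx|[k _ /=]]; last first.
  by apply: lt_le_trans; rewrite invr_gt0.
by have [k] := ltr_add_invr fx; rewrite add0r => /ltW ?; exists k.
Qed.

End bounded_integrals.

Section images.
Context d d' {T : measurableType d} {U : measurableType d'} {R : realType}.

Lemma bmeas_comp (f : U -> R) (g : T -> U) :
  measurable_fun setT g -> bmeas f -> bmeas (f \o g).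
Proof.
move=> mg [mf [M fM]]; split; last by exists M => x; exact: fM.
exact: measurableT_comp.
Qed.

Lemma Rint_image (P : probability T R) (Q : probability U R) (g : T -> U) f :
  measurable_fun setT g -> (forall A, measurable A -> P (g @^-1` A) = Q A) ->
  bmeas f -> \int[P]_x f (g x) = \int[Q]_y f y.
Proof.
move=> mg PQ bf; congr fine.
rewrite (@eq_measure_integral _ _ _ setT (pushforward P g) Q); last first.
  by move=> A mA _; exact/esym/PQ.
rewrite integral_pushforward//; first exact/measurable_EFinP/bf.1.
rewrite preimage_setT; exact: (bmeas_integrable _ (bmeas_comp mg bf)).
Qed.

End images.

(** * Mixtures and conditional measures *)

Section construction.
Context d {T : measurableType d} {R : realType}.

Section mkprob.
Variables (m : {measure set T -> \bar R}) (m1 : m setT = 1%E).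
Definition mkprob_def : set T -> \bar R := m.
HB.instance Definition _ := Measure.on mkprob_def.
HB.instance Definition _ := Measure_isProbability.Build _ _ _ mkprob_def m1.
Definition mkprob : probability T R := mkprob_def.
End mkprob.

Lemma pmix_exists (l : R) (P Q : probability T R) : 0 <= l <= 1 ->
  exists S : probability T R,
    forall A, measurable A -> S A = (l * pr P A + (1 - l) * pr Q A)%:E.
Proof.
move=> /andP[l0 l1].
have l1' : 0 <= 1 - l by rewrite subr_ge0.
pose m := measure_add (mscale (NngNum l0) P) (mscale (NngNum l1') Q).
have mE A : measurable A -> m A = (l * pr P A + (1 - l) * pr Q A)%:E.
  move=> mA; rewrite /m measure_addE /mscale/= EFinD !EFinM !EFin_pr//.
have m1 : m setT = 1%E by rewrite mE// !prT !mulr1 addrCA subrr addr0.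
by exists (mkprob m1).
Qed.

Lemma pcond_exists (P : probability T R) (B : set T) : measurable B ->
  0 < pr P B -> exists S : probability T R,
    forall A, measurable A -> S A = ((pr P B)^-1 * pr P (A `&` B))%:E.
Proof.
move=> mB B0.
have i0 : 0 <= (pr P B)^-1 by rewrite invr_ge0 ltW.
pose m := mscale (NngNum i0) (mrestr P mB).
have mE A : measurable A -> m A = ((pr P B)^-1 * pr P (A `&` B))%:E.
  move=> mA; rewrite /m /mscale/= /mrestr EFinM EFin_pr//; exact: measurableI.
have m1 : m setT = 1%E by rewrite mE// setTI mulVf// gt_eqF.
by exists (mkprob m1).
Qed.

End construction.

(** * Borel sets of products *)

Lemma pimage_exists d d' (T : measurableType d) (U : measurableType d')
    (R : realType) (P : probability T R) (g : T -> U) :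
  measurable_fun setT g ->
  exists Q : probability U R, forall A, Q A = P (g @^-1` A).
Proof.
move=> mg.
pose m : {measure set U -> \bar R} :=
  measure_function_pushforward__canonical__measure_function_Measure P mg.
have m1 : m setT = 1%E.
  rewrite /m /= /pushforward preimage_setT; exact: probability_setT.
by exists (mkprob m1).
Qed.

Section borel_measurability.
Context {R : realType}.

Lemma measurable_open (T : ptopologicalType) (U : set T) :
  open U -> measurable (U : set (borel T)).
Proof. by move=> oU; exact: sub_sigma_algebra. Qed.

Lemma measurable_closed (T : ptopologicalType) (U : set T) :
  closed U -> measurable (U : set (borel T)).
Proof.
move=> cU; rewrite -(setCK U); apply: measurableC; apply: measurable_open.
exact: closed_openC.
Qed.

Lemma continuous_borel (T U : ptopologicalType) (f : T -> U) : continuous f ->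
  measurable_fun setT (f : borel T -> borel U).
Proof.
move=> /continuousP cf.
apply: (@measurability _ _ (borel T) (borel U) setT f (@open U) erefl).
by move=> _ [B oB <-]; rewrite setTI; apply: measurable_open; exact: cf.
Qed.

Lemma continuous_borelR (T : ptopologicalType) (f : T -> R) : continuous f ->
  measurable_fun setT (f : borel T -> R).
Proof.
move=> /continuousP cf; apply: (measurability _ (RGenOpens.measurableE R)).
move=> _ [_ [a [b ->] <-]]; rewrite setTI; apply: measurable_open.
exact/cf/interval_open.
Qed.

Lemma measurable_fst_borel (T : ptopologicalType) :
  measurable_fun setT (fst : borel (T * T)%type -> borel T).
Proof. by apply: (@continuous_borel (T * T)%type T) => z; exact: cvg_fst. Qed.

Lemma measurable_snd_borel (T : ptopologicalType) :
  measurable_fun setT (snd : borel (T * T)%type -> borel T).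
Proof. by apply: (@continuous_borel (T * T)%type T) => z; exact: cvg_snd. Qed.

Lemma measurable_rectangle (T : ptopologicalType) (A B : set (borel T)) :
  measurable A -> measurable B -> measurable (A `*` B : set (borel (T * T)%type)).
Proof.
move=> mA mB.
rewrite (_ : A `*` B = fst @^-1` A `&` snd @^-1` B)//.
apply: measurableI.
  by have := @measurable_fst_borel T measurableT _ mA; rewrite setTI.
by have := @measurable_snd_borel T measurableT _ mB; rewrite setTI.
Qed.

End borel_measurability.

Section metric.
Context {R : realType} {X : pmetricType R}.
Implicit Types (x y z w : X) (e r : R).

Lemma mdist_lipschitz x y z w :
  `|mdist x y - mdist z w| <= mdist x z + mdist y w.
Proof.
have h1 := metric_triangle x z y; have h2 := metric_triangle z w y.
have h3 := metric_triangle z x w; have h4 := metric_triangle x y w.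
rewrite (metric_sym w y) in h2; rewrite (metric_sym z x) in h3.
rewrite ler_norml; apply/andP; split; lra.
Qed.

Lemma nbhs_mdist_lt x e : 0 < e -> \forall y \near x, mdist x y < e.
Proof.
move=> e0; have := nbhsx_ballx x e e0; rewrite ballEmdist; exact.
Qed.

Lemma continuous_mdist2 : continuous (fun u : X * X => mdist u.1 u.2).
Proof.
move=> [x y]; apply/cvgrPdist_lt => e e0 /=.
have e20 : 0 < e / 2 by rewrite divr_gt0.
exists ([set z | mdist x z < e / 2], [set w | mdist y w < e / 2]) => /=.
  by split; exact: nbhs_mdist_lt.
move=> [z w] /= [xz yw]; rewrite (le_lt_trans (mdist_lipschitz _ _ _ _))//.
by rewrite [ltRHS]splitr ltrD.
Qed.

Lemma continuous_mdist x : continuous (fun z : X => mdist x z).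
Proof.
move=> y; apply/cvgrPdist_lt => e e0 /=.
near=> w; rewrite (le_lt_trans (mdist_lipschitz _ _ _ _))// mdistxx add0r.
near: w; exact: nbhs_mdist_lt.
Unshelve. all: by end_near. Qed.

Definition totally_bounded_seq := forall e, 0 < e ->
  exists s : seq X, forall x, exists2 y, y \in s & mdist y x < e.

Lemma open_mdistP (U : set X) : open U <->
  forall x, U x -> exists2 e, 0 < e & forall y, mdist x y < e -> U y.
Proof.
rewrite openE; split => [oU x /oU|h x /h [e e0 xU]].
  rewrite /interior -nbhs_ballE => -[e /= e0]; rewrite ballEmdist => xU.
  by exists e.
by rewrite /interior; apply: filterS (nbhs_mdist_lt x e0).
Qed.

Lemma open_mdist_lt x e : open [set y | mdist x y < e].
Proof.
apply/open_mdistP => y /= xy; exists (e - mdist x y); first by rewrite subr_gt0.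
by move=> z; rewrite ltrBrDl; apply: le_lt_trans; exact: metric_triangle.
Qed.

Hypothesis tb : totally_bounded_seq.

(** Total boundedness gives a finite 1/(k+1)-net for every k, and the balls of these radii around
    the net points form a countable base. An open set of the product is therefore a countable union
    of open rectangles. This makes the Borel sets of [X * X] measurable for the product
    sigma-algebra, so that product measures are available as couplings. *)
Lemma open_prod_measurable (U : set (X * X)) : open U ->
  measurable (U : set (borel X * borel X)%type).
Proof.
move=> oU.
have inv0 k : 0 < k.+1%:R^-1 :> R by rewrite invr_gt0.
have /choice[s sP] := fun k => tb (inv0 k).
pose b k i := [set z : X | mdist (nth point (s k) i) z < k.+1%:R^-1].
(* An index beyond the length of [s k] yields a ball around [point]; this is harmless, since only
   rectangles contained in [U] are kept. *)
pose F k i j : set (borel X * borel X)%type :=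
  if pselect (b k i `*` b k j `<=` U) then b k i `*` b k j
  else set0.
have mF k i j : measurable (F k i j : set (borel X * borel X)%type).
  rewrite /F; case: pselect => /= ?; last exact: measurable0.
  apply: measurableX.
    by apply: measurable_open; exact: open_mdist_lt.
  by apply: measurable_open; exact: open_mdist_lt.
rewrite (_ : U = \bigcup_k \bigcup_i \bigcup_j F k i j); last first.
  apply/seteqP; split => [[x y] Uxy|u [k _ [i _ [j _]]]]; last first.
    by rewrite /F; case: pselect => [bU /bU|_ []].
  have : nbhs (x, y) U by exact: open_nbhs_nbhs.
  move=> [[A B] /= [nA nB] ABU].
  have [a a0 aA] : exists2 e, 0 < e & forall z, mdist x z < e -> A z.
    by move: nA; rewrite -nbhs_ballE => -[e /= e0]; rewrite ballEmdist; exists e.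
  have [c c0 cB] : exists2 e, 0 < e & forall z, mdist y z < e -> B z.
    by move: nB; rewrite -nbhs_ballE => -[e /= e0]; rewrite ballEmdist; exists e.
  (* The radius is halved because a ball of radius 1/(k+1) around a net point near [x] reaches up to
     2/(k+1) away from [x]. *)
  have m0 : 0 < Num.min a c / 2 by rewrite divr_gt0// lt_min a0.
  have [k] := ltr_add_invr m0; rewrite add0r => kac.
  have [ka kc] : k.+1%:R^-1 + k.+1%:R^-1 < a /\ k.+1%:R^-1 + k.+1%:R^-1 < c.
    by move: kac; rewrite ltr_pdivlMr// lt_min mulr_natr mulr2n => /andP[].
  have [x' x's x'x] := sP k x; have [y' y's y'y] := sP k y.
  exists k => //; exists (index x' (s k)) => //; exists (index y' (s k)) => //.
  rewrite /F; case: pselect => /= [_|].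
    by rewrite /b; split; rewrite /= nth_index.
  case => -[z w] [/=]; rewrite /b /= !nth_index// => xz yw.
  apply: ABU; split => /=.
    apply: aA; apply: le_lt_trans (metric_triangle x x' z) _.
    by rewrite (metric_sym x x') (lt_trans (ltrD x'x xz)).
  apply: cB; apply: le_lt_trans (metric_triangle y y' w) _.
  by rewrite (metric_sym y y') (lt_trans (ltrD y'y yw)).
by apply: bigcupT_measurable => k; apply: bigcupT_measurable => i;
  apply: bigcupT_measurable => j.
Qed.

Lemma measurable_borel_prod :
  measurable_fun setT (id : (borel X * borel X)%type -> borel (X * X)%type).
Proof.
apply: (@measurability _ _ (borel X * borel X)%type (borel (X * X)%type)
  setT id (@open (X * X)%type) erefl).
by move=> _ [B oB <-]; rewrite setTI; exact: open_prod_measurable.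
Qed.

Lemma pprod_exists (P Q : probability (borel X) R) :
  exists pi : probability (borel (X * X)%type) R,
    forall E : set (X * X), pi E = (P \x Q)%E E.
Proof.
have [pi piE] := pimage_exists (P \x Q)%E measurable_borel_prod.
by exists pi => E; rewrite piE.
Qed.

End metric.

(** * Couplings and potentials *)

Section wasserstein_bounded.
Context {R : realType} {X : pmetricType R} {p D : R}.
Hypotheses (p1 : 1 <= p) (diam : forall x y : X, mdist x y <= D).
Implicit Types (x y z w : X) (mu nu : wasserstein X p).

Local Notation c x y := (mdist x y `^ p).

Let p0 : 0 < p. Proof. exact: lt_le_trans p1. Qed.

Let c_ge0 x y : 0 <= c x y. Proof. exact: powR_ge0. Qed.

Lemma cost_sym x y : c x y = c y x. Proof. by rewrite metric_sym. Qed.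

Lemma costxx x : c x x = 0. Proof. by rewrite mdistxx powR0// gt_eqF. Qed.

Lemma ler_cost x y z w : (c x y <= c z w) = (mdist x y <= mdist z w).
Proof.
apply/idP/idP => [|h]; last by rewrite ge0_ler_powR ?nnegrE ?mdist_ge0// ltW.
by apply: contraTT; rewrite -!ltNge => h;
  rewrite gt0_ltr_powR ?nnegrE ?mdist_ge0.
Qed.

Lemma ltr_cost x y z w : (c x y < c z w) = (mdist x y < mdist z w).
Proof. by rewrite !ltNge ler_cost. Qed.

Lemma cost_inj x y z w : c x y = c z w -> mdist x y = mdist z w.
Proof. by move/eqP; rewrite eq_le !ler_cost -eq_le => /eqP. Qed.

Lemma bmeas_cost2 : bmeas (fun u : borel (X * X)%type => c (u.1 : X) (u.2 : X)).
Proof.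
split.
  apply: (measurableT_comp (measurable_powR p)).
  by apply: (@continuous_borelR _ (X * X)%type); exact: continuous_mdist2.
exists (D `^ p) => u; rewrite ger0_norm// ge0_ler_powR ?nnegrE ?mdist_ge0//.
  exact: ltW.
exact: le_trans (mdist_ge0 point point) (diam _ _).
Qed.

Lemma bmeas_cost x : bmeas (fun z : borel X => c x (z : X)).
Proof.
split.
  apply: (measurableT_comp (measurable_powR p)).
  by apply: continuous_borelR; exact: continuous_mdist.
exists (D `^ p) => u; rewrite ger0_norm// ge0_ler_powR ?nnegrE ?mdist_ge0//.
  exact: ltW.
exact: le_trans (mdist_ge0 point point) (diam _ _).
Qed.

Lemma wmoment_bounded (P : probability (borel X) R) x :
  (\int[P]_(z in [set: borel X]) (mdist (z : X) x `^ p)%:E < +oo)%E.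
Proof.
under eq_integral do rewrite metric_sym.
rewrite -EFin_Rint ?ltry//; exact: bmeas_cost.
Qed.

Definition towass (P : probability (borel X) R) : wasserstein X p :=
  to_wasserstein (@wmoment_bounded P).

Lemma pr_towass P (A : set (borel X)) : measurable A -> pr (towass P) A = pr P A.
Proof. by move=> mA; rewrite /pr to_wassersteinE. Qed.

Lemma wass_eqP mu nu : (forall A : set (borel X), measurable A ->
  pr mu A = pr nu A) -> mu = nu.
Proof.
move=> munu; apply: wasserstein_eq => A mA.
by rewrite -[LHS]EFin_pr// munu// EFin_pr.
Qed.

Definition wdirac x : wasserstein X p := towass (@dirac _ (borel X) x R).

Lemma pr_wdirac x (A : set (borel X)) : measurable A -> pr (wdirac x) A = \1_A x.
Proof. by move=> mA; rewrite pr_towass// /pr/= diracE indicE. Qed.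

Lemma measurable_point x : measurable ([set x] : set (borel X)).
Proof.
apply: measurable_closed; apply: accessible_closed_set1.
by apply: hausdorff_accessible; exact: metric_hausdorff.
Qed.

Lemma eq_wdirac nu x : pr nu [set x] = 1 -> nu = wdirac x.
Proof.
move=> nux; apply: wass_eqP => A mA; rewrite pr_wdirac//.
rewrite -(prI1 mA (measurable_point x))//= indicE.
have [xA|xA] := boolP (x \in A).
  by rewrite (_ : A `&` _ = [set x])// setIC set1I xA.
by rewrite setIC set1I (negbTE xA) pr0.
Qed.

Section couplings.
Variables (mu nu : wasserstein X p) (pi : probability (borel (X * X)%type) R).
Hypothesis cpi : coupling mu nu pi.

Lemma coupling_pr1 (A : set (borel X)) :
  measurable A -> pr pi (A `*` setT) = pr mu A.
Proof. by move=> mA; rewrite /pr cpi.1. Qed.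

Lemma coupling_pr2 (A : set (borel X)) :
  measurable A -> pr pi (setT `*` A) = pr nu A.
Proof. by move=> mA; rewrite /pr cpi.2. Qed.

Lemma coupling_Rint1 (u : borel X -> R) : bmeas u ->
  \int[pi]_z u (z.1 : X) = \int[mu]_x u x.
Proof.
move=> bu; apply: (Rint_image (@measurable_fst_borel X)) => // A mA.
by rewrite -cpi.1// setXT.
Qed.

Lemma coupling_Rint2 (u : borel X -> R) : bmeas u ->
  \int[pi]_z u (z.2 : X) = \int[nu]_x u x.
Proof.
move=> bu; apply: (Rint_image (@measurable_snd_borel X)) => // A mA.
by rewrite -cpi.2// setTX.
Qed.

Lemma bmeas1 (u : borel X -> R) : bmeas u ->
  bmeas (fun z : borel (X * X)%type => u (z.1 : X)).
Proof. by move=> bu; exact: (bmeas_comp (@measurable_fst_borel X) bu). Qed.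

Lemma bmeas2 (u : borel X -> R) : bmeas u ->
  bmeas (fun z : borel (X * X)%type => u (z.2 : X)).
Proof. by move=> bu; exact: (bmeas_comp (@measurable_snd_borel X) bu). Qed.

End couplings.

(** Equal distances mean equal infima of costs, once the root is undone by raising to the power [p];
    both infima are nonnegative. In this form the equality can be exploited without knowing that
    optimal couplings exist. *)
Lemma wdist_cost mu nu mu' nu' (A : R)
    (pi' : probability (borel (X * X)%type) R) :
  wdist mu nu = wdist mu' nu' ->
  (forall pi, coupling mu nu pi -> A <= \int[pi]_z c (z.1 : X) (z.2 : X)) ->
  coupling mu' nu' pi' -> A <= \int[pi']_z c (z.1 : X) (z.2 : X).
Proof.
rewrite /wdist => E lb cpi'; rewrite -lee_fin EFin_Rint; last exact: bmeas_cost2.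
set I := ereal_inf _ in E; set I' := ereal_inf _ in E.
have I0 : (0 <= I)%E.
  apply: le_ereal_inf_tmp => _ [pi _ <-]; apply: integral_ge0 => z _.
  by rewrite lee_fin.
have I'0 : (0 <= I')%E.
  apply: le_ereal_inf_tmp => _ [pi _ <-]; apply: integral_ge0 => z _.
  by rewrite lee_fin.
have {}E : I = I'.
  have pV : p^-1 * p = 1 by rewrite mulVf// gt_eqF.
  by rewrite -(poweRe1 I0) -(poweRe1 I'0) -pV !poweRrM E.
apply: (@le_trans _ _ I).
  apply: le_ereal_inf_tmp => _ [pi cpi <-].
  by rewrite -EFin_Rint ?lee_fin; [exact: lb|exact: bmeas_cost2].
by rewrite E; apply: ereal_inf_lbound; exists pi'.
Qed.

(** By [coupling_dirac] every coupling of [mu] with the Dirac mass at [y] costs exactly this much,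
    so this is the [p]-th power of their distance. *)
Definition pot mu y : R := \int[mu]_z c y (z : X).

Lemma coupling_dirac mu y pi : coupling mu (wdirac y) pi ->
  \int[pi]_z c (z.1 : X) (z.2 : X) = pot mu y.
Proof.
move=> cpi; rewrite /pot -[RHS](coupling_Rint1 cpi (bmeas_cost y)).
have my := measurable_point y.
pose S : set (borel (X * X)%type) := [set: borel X] `*` [set y].
apply: (@eq_Rint _ (borel (X * X)%type) R pi S).
- exact: measurable_rectangle.
- by rewrite (coupling_pr2 cpi)// pr_wdirac// indicE mem_set.
- exact: bmeas_cost2.
- exact: bmeas1 (bmeas_cost y).
- by move=> [z w] [_ /= ->]; rewrite cost_sym.
Qed.

Hypothesis tb : @totally_bounded_seq R X.

Lemma coupling_prod mu nu : exists2 pi, coupling mu nu pi &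
  forall E : set (X * X), pi E = (mu \x nu)%E E.
Proof.
have [pi piE] := pprod_exists tb mu nu; exists pi => //; split => A mA.
  rewrite piE; apply: etrans (product_measure1E _ _ mA measurableT) _.
  by rewrite -[RHS]mule1; congr (_ * _)%E; exact: probability_setT.
rewrite piE; apply: etrans (product_measure1E _ _ measurableT mA) _.
by rewrite -[RHS]mul1e; congr (_ * _)%E; exact: probability_setT.
Qed.

Lemma pot_eq mu mu' y y' : wdist mu (wdirac y) = wdist mu' (wdirac y') ->
  pot mu y = pot mu' y'.
Proof.
have le mu1 mu2 y1 y2 : wdist mu1 (wdirac y1) = wdist mu2 (wdirac y2) ->
    pot mu1 y1 <= pot mu2 y2.
  move=> E; have [pi cpi _] := coupling_prod mu2 (wdirac y2).
  rewrite -(coupling_dirac cpi); apply: wdist_cost E _ cpi => pi' cpi'.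
  by rewrite (coupling_dirac cpi').
by move=> E; apply/eqP; rewrite eq_le !le.
Qed.

Lemma pot_wdirac x y : pot (wdirac x) y = c y x.
Proof.
rewrite /pot (@eq_Rint _ _ _ _ ([set x] : set (borel X)) _ (cst (c y x))).
- by rewrite Rint_cst.
- exact: measurable_point.
- by rewrite pr_wdirac ?indicE ?mem_set//; exact: measurable_point.
- exact: bmeas_cost.
- exact: bmeas_cst.
- by move=> _ ->.
Qed.

Lemma wdirac_dist_inj x y x' y' :
  wdist (wdirac x) (wdirac y) = wdist (wdirac x') (wdirac y') ->
  mdist x y = mdist x' y'.
Proof.
move=> /pot_eq; rewrite !pot_wdirac => /cost_inj; rewrite metric_sym => ->.
exact: metric_sym.
Qed.

(** The product coupling of [mu] and [nu] must cost at least the maximal value D^p, so almost all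
    pairs are at distance [D]. By Fubini some [z] is at distance [D] from [nu]-almost every
    point. *)
Lemma diam_wdist_section mu nu x y : mdist x y = D ->
  wdist (wdirac x) (wdirac y) = wdist mu nu ->
  exists z, pr nu [set w | mdist z w < D] = 0.
Proof.
move=> xyD E.
have [pi cpi piE] := coupling_prod mu nu.
have piD : D `^ p <= \int[pi]_z c (z.1 : X) (z.2 : X).
  apply: wdist_cost E _ cpi => pi' cpi'.
  by rewrite (coupling_dirac cpi') pot_wdirac metric_sym xyD.
pose f (u : borel (X * X)%type) := D `^ p - c (u.1 : X) (u.2 : X).
have bf : bmeas f by apply: bmeasB; [exact: bmeas_cst|exact: bmeas_cost2].
have f0 u : 0 <= f u.
  by rewrite /f -xyD subr_ge0 ler_cost xyD diam.
have If : \int[pi]_u f u <= 0.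
  rewrite /f RintB; [|exact: bmeas_cst|exact: bmeas_cost2].
  by rewrite Rint_cst subr_le0.
have := Rint_ge0_pr_gt0 bf f0 If.
set E0 := [set u | _] => piE0.
pose E1 : set (borel X * borel X)%type := [set u | mdist (u.1 : X) (u.2 : X) < D].
have E01 : E0 = E1 :> set (X * X).
  by apply/funext => -[z w]; rewrite /E0 /E1 /f /= subr_gt0 -xyD ltr_cost.
have oE1 : open (E1 : set (X * X)).
  rewrite (_ : E1 = (fun u : X * X => mdist u.1 u.2) @^-1` [set r : R | r < D])//.
  by apply: open_comp => [u _|]; [exact: continuous_mdist2|exact: open_lt].
(* Sections are taken for the product sigma-algebra, so Borel measurability in [X * X] alone would
   not suffice here. *)
have mE1 : measurable E1 by exact: open_prod_measurable.
have mnu := measurable_fun_xsection nu mE1.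
pose g (z : borel X) := pr nu (xsection E1 z).
have mxs z : measurable (xsection E1 z : set (borel X)) by exact: measurable_xsection.
have bg : bmeas g.
  split.
    apply/measurable_EFinP; apply: eq_measurable_fun mnu => z _.
    by rewrite /= EFin_pr.
  by exists 1 => z; rewrite ger0_norm ?pr_ge0// pr_le1.
have Ig : \int[mu]_z g z <= 0.
  rewrite -lee_fin EFin_Rint// (eq_integral (nu \o xsection E1)).
    have := congr1 EFin piE0; rewrite E01 EFin_pr; last exact: measurable_open.
    by rewrite piE => <-.
  by move=> z _; rewrite /= /g EFin_pr.
have mug := Rint_ge0_pr_gt0 bg (fun z => pr_ge0 _ _) Ig.
have [z gz] : exists z, g z <= 0.
  apply: contrapT => h; have : pr mu setT = 0.
    rewrite -mug; congr pr; apply/esym/seteqP; split => // z _ /=.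
    by rewrite ltNge; apply/negP => gz; apply: h; exists z.
  by rewrite prT => /eqP; rewrite oner_eq0.
exists z; apply/eqP; rewrite eq_le pr_ge0 andbT; apply: le_trans gz.
rewrite /g (_ : xsection E1 z = [set w | mdist z w < D])//.
by apply/funext => w; rewrite xsectionE.
Qed.

End wasserstein_bounded.

Lemma pr_bigcap_lt d (T : measurableType d) (R : realType)
    (P : probability T R) (F : (set T)^nat) (l : R) :
  (forall n, measurable (F n)) -> nonincreasing_seq F ->
  pr P (\bigcap_n F n) < l -> exists n, pr P (F n) < l.
Proof.
move=> mF dF Fl.
have mFI : measurable (\bigcap_n F n) by exact: bigcapT_measurable.
have F0y : (P (F 0%N) < +oo)%E by rewrite -ge0_fin_numE// fin_num_measure.
have cF := nonincreasing_cvg_mu F0y mF mFI dF.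
have : nbhs (P (\bigcap_n F n)) [set y | (y < l%:E)%E].
  apply: open_nbhs_nbhs; split; first exact: open_ereal_lt_ereal.
  by rewrite /= -EFin_pr// lte_fin.
move=> /cF [n _ /(_ n (leqnn n))] /=; rewrite -EFin_pr// lte_fin => ?.
by exists n.
Qed.

Lemma indic1E (R : realType) (T : eqType) (a b : T) :
  (\1_[set a] b : R) = (b == a)%:R.
Proof.
rewrite indicE; case: eqVneq => [->|/eqP h]; first by rewrite mem_set.
by rewrite memNset.
Qed.

(** * Mixtures of two Dirac masses and the detection of atoms *)

Section transport.
Context {R : realType} {X : pmetricType R} {p D : R}.
Hypotheses (p1 : 1 <= p) (diam : forall x y : X, mdist x y <= D).
Hypothesis tb : @totally_bounded_seq R X.
Implicit Types (x y z w a b : X) (mu nu : wasserstein X p) (l : R).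

Local Notation c x y := (mdist x y `^ p).

(** The coupling is the mixture, with weights [l] and [1 - l], of the products of [P1] with [Q1] and
    of [P2] with [Q2]: each part of the mass is sent to its own target. *)
Lemma coupling_split mu nu l (P1 P2 Q1 Q2 : probability (borel X) R) :
  0 <= l <= 1 ->
  (forall A, measurable A -> pr mu A = l * pr P1 A + (1 - l) * pr P2 A) ->
  (forall A, measurable A -> pr nu A = l * pr Q1 A + (1 - l) * pr Q2 A) ->
  exists2 pi, coupling mu nu pi & forall A B : set (borel X),
    measurable A -> measurable B ->
    pr pi (A `*` B) = l * (pr P1 A * pr Q1 B) + (1 - l) * (pr P2 A * pr Q2 B).
Proof.
move=> l01 muE nuE.
have [pi1 pi1E] := pprod_exists tb P1 Q1.
have [pi2 pi2E] := pprod_exists tb P2 Q2.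
have [pi piE] := pmix_exists pi1 pi2 l01.
have prE (A B : set (borel X)) : measurable A -> measurable B ->
    pr pi (A `*` B) = l * (pr P1 A * pr Q1 B) + (1 - l) * (pr P2 A * pr Q2 B).
  move=> mA mB; rewrite /pr piE /=; last exact: measurable_rectangle.
  rewrite /pr pi1E pi2E.
  rewrite [X in l * fine X](product_measure1E _ _ mA mB).
  rewrite [X in (1 - l) * fine X](product_measure1E _ _ mA mB).
  by rewrite !fineM// ?fin_num_measure.
exists pi => //; split => A mA.
  rewrite -(EFin_pr mu mA) -EFin_pr; last exact: measurable_rectangle.
  by rewrite prE// muE// !prT !mulr1.
rewrite -(EFin_pr nu mA) -EFin_pr; last exact: measurable_rectangle.
by rewrite prE// nuE// !prT !mul1r.
Qed.

Definition is_mix l a b nu := forall A : set (borel X), measurable A ->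
  pr nu A = l * \1_A a + (1 - l) * \1_A b.

Lemma mix_exists l a b : 0 <= l <= 1 -> exists nu, is_mix l a b nu.
Proof.
move=> l01.
have [P PE] := pmix_exists (wdirac p1 diam a) (wdirac p1 diam b) l01.
exists (towass p1 diam P) => A mA.
rewrite pr_towass//.
by have := congr1 fine (PE A mA); rewrite !(pr_wdirac p1 diam _ mA).
Qed.

Lemma mix_swap l a b nu : is_mix l a b nu -> is_mix (1 - l) b a nu.
Proof. by move=> nuE A mA; rewrite nuE//; ring. Qed.

Section mix.
Variables (l : R) (a b : X) (nu : wasserstein X p).
Hypotheses (ab : a != b) (nuE : is_mix l a b nu).

Let ma := measurable_point (R := R) a.
Let mb := measurable_point (R := R) b.
Let mab : measurable ([set a] `|` [set b] : set (borel X)).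
Proof. exact: measurableU. Qed.

Let disj : [set a] `&` [set b] = set0.
Proof. by apply/seteqP; split => // z [/= -> /= /eqP]; rewrite (negbTE ab). Qed.

Lemma pr_mix1 : pr nu [set a] = l.
Proof.
by rewrite nuE// !indic1E eqxx eq_sym (negbTE ab) mulr1 mulr0 addr0.
Qed.

Lemma pr_mix2 : pr nu [set b] = 1 - l.
Proof.
by rewrite nuE// !indic1E eqxx (negbTE ab) mulr1 mulr0 add0r.
Qed.

Lemma pr_mixU : pr nu ([set a] `|` [set b]) = 1.
Proof.
rewrite nuE// !indicE !mem_set/=; [|by right|by left].
by rewrite !mulr1 addrC subrK.
Qed.

Lemma Rint_two_points mu (u : borel X -> R) :
  pr mu ([set a] `|` [set b]) = 1 -> bmeas u ->
  \int[mu]_z u z = u a * pr mu [set a] + u b * pr mu [set b].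
Proof.
move=> mu1 bu.
have bia := bmeas_indic (R := R) ma; have bib := bmeas_indic (R := R) mb.
rewrite (@eq_Rint _ _ _ _ _ _
  (fun z : borel X => u a * \1_[set a] z + u b * \1_[set b] z) _ mu1)//.
- by rewrite RintD ?RintZ ?Rint_indic//; exact: bmeasZ.
- by apply: bmeasD; exact: bmeasZ.
move=> z [->|->]; rewrite !indic1E eqxx ?[b == a]eq_sym (negbTE ab);
  by rewrite mulr1 mulr0 ?addr0 ?add0r.
Qed.

Lemma Rint_mix (u : borel X -> R) : bmeas u ->
  \int[nu]_z u z = l * u a + (1 - l) * u b.
Proof.
move=> bu; rewrite Rint_two_points//; last exact: pr_mixU.
by rewrite pr_mix1 pr_mix2 [u a * _]mulrC [u b * _]mulrC.
Qed.

Lemma pot_mix y : pot nu y = l * c y a + (1 - l) * c y b.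
Proof. by rewrite /pot Rint_mix//; exact: (bmeas_cost p1 diam). Qed.

Lemma eq_mix mu : pr mu ([set a] `|` [set b]) = 1 -> pr mu [set a] = l ->
  mu = nu.
Proof.
move=> mu1 mua.
have mub : pr mu [set b] = 1 - l.
  by rewrite -mu1 -mua prU// addrC addKr.
apply: wass_eqP => A mA; rewrite -!Rint_indic//.
have biA := bmeas_indic (R := R) mA.
by rewrite Rint_mix// Rint_two_points// mua mub mulrC [X in _ + X]mulrC.
Qed.

(** The potential at [a] of a measure carried by [a] and [b] is its mass at [b] times the positive
    number [c a b]. *)
Lemma eq_mix_of_pot mu : pr mu ([set a] `|` [set b]) = 1 ->
  pot mu a = pot nu a -> mu = nu.
Proof.
move=> muab munu; apply: eq_mix => //.
have cab : 0 < c a b by rewrite powR_gt0// mdist_gt0.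
have := munu; rewrite pot_mix {1}/pot Rint_two_points//; last exact: bmeas_cost.
rewrite costxx// mul0r mulr0 !add0r mulrC => /(mulIf (lt0r_neq0 cab)) mub.
have : pr mu [set a] + pr mu [set b] = 1.
  by rewrite -muab prU.
by rewrite mub; lra.
Qed.

(** The function [f] below is nonnegative and vanishes only at [a] and [b]. Its integral is a
    combination of potentials at [a'] and [b'], hence is the same for [mu] as for [nu], namely zero.
    So [mu] is carried by the two points, and one potential fixes the weights. *)
Lemma mix_of_pot a' b' M mu :
  (forall z, z != a -> z != b -> c a' z + c b' z < M) ->
  c a' a + c b' a = M -> c a' b + c b' b = M ->
  (forall y, pot mu y = pot nu y) -> mu = nu.
Proof.
move=> hM Ma Mb munu.
pose f (z : borel X) := M - (c a' (z : X) + c b' (z : X)).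
have ba' := bmeas_cost p1 diam a'; have bb' := bmeas_cost p1 diam b'.
have bf : bmeas f by apply: bmeasB; [exact: bmeas_cst|exact: bmeasD].
have f0 z : 0 <= f z.
  rewrite /f subr_ge0; have [->|za] := eqVneq (z : X) a; first by rewrite Ma.
  by have [->|zb] := eqVneq (z : X) b; [rewrite Mb|rewrite ltW ?hM].
have If : \int[mu]_z f z <= 0.
  rewrite /f RintB ?RintD//; [|exact: bmeas_cst|exact: bmeasD].
  rewrite Rint_cst -!/(pot _ _) !munu !pot_mix subr_le0 le_eqVlt.
  apply/orP; left; apply/eqP.
  transitivity (l * (c a' a + c b' a) + (1 - l) * (c a' b + c b' b)); last by ring.
  by rewrite Ma Mb; ring.
have muab : pr mu ([set a] `|` [set b]) = 1.
  apply/eqP; rewrite eq_le pr_le1//=.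
  have := Rint_ge0_pr_gt0 bf f0 If; set E := [set z | _] => E0.
  have mC : measurable (~` ([set a] `|` [set b]) : set (borel X)) by exact: measurableC.
  have : pr mu (~` ([set a] `|` [set b])) <= 0.
    rewrite -E0; apply: le_pr => //.
      have := bf.1 measurableT _ (measurable_itv `]0, +oo[).
      by rewrite setTI set_itvE.
    move=> z /not_orP[/eqP za /eqP zb]; rewrite /E /= /f subr_gt0.
    exact: hM.
  by rewrite prC//; lra.
exact: eq_mix_of_pot.
Qed.

End mix.

(* If [z0] carries mass at least [l], sending a part [l] of that mass to [a] and
   everything else to [b] costs [pot mu b + l * (c a z0 - c b z0)]; any coupling
   of a measure with less mass at [z0] costs strictly more. *)
Lemma mix_detect mu mu' nu l a b z0 : a != b -> is_mix l a b nu -> 0 < l ->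
  (forall z, z != z0 -> c a z0 - c b z0 < c a z - c b z) ->
  pot mu b = pot mu' b -> wdist mu nu = wdist mu' nu ->
  l <= pr mu [set z0] -> pr mu [set z0] < 1 -> l <= pr mu' [set z0].
Proof.
move=> ab nuE l0 gz0 potE E lm m1; rewrite leNgt; apply/negP => ltl.
have ma := measurable_point a; have mb := measurable_point b.
have mz0 := measurable_point z0.
have mab : measurable ([set a] `|` [set b] : set (borel X)) by exact: measurableU.
have ba' := bmeas_cost p1 diam a; have bb' := bmeas_cost p1 diam b.
pose g (z : borel X) := c a (z : X) - c b (z : X); pose g0 := c a z0 - c b z0.
have bg : bmeas g by exact: bmeasB.
(* These sublevel sets decrease to the strict minimum point [z0] of [g]. Since [mu'] has mass below
   [l] at [z0], it has mass below [l] on some [F k]; outside [F k] the function [g] exceeds its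
   minimum by at least 1/(k+1), which becomes [eta]. *)
pose F k : set (borel X) := [set z | g z < g0 + k.+1%:R^-1].
have mF k : measurable (F k).
  have := bg.1 measurableT _ (measurable_itv `]-oo, (g0 + k.+1%:R^-1)[).
  by rewrite setTI set_itvE.
have [k Fk] : exists k, pr mu' (F k) < l.
  apply: pr_bigcap_lt => //.
    move=> i j ij; apply/subsetPset => z; rewrite /F /= => /lt_le_trans; apply.
    by rewrite lerD2l lef_pV2 ?posrE// ler_nat.
  rewrite (_ : \bigcap_n F n = [set z0])//.
  apply/seteqP; split => z /= => [zF|-> n _]; last by rewrite /F /= ltrDl invr_gt0.
  apply/eqP; apply/negPn/negP => /gz0; rewrite -subr_gt0 => h.
  have [n] := ltr_add_invr h; rewrite add0r.
  by have := zF n I; rewrite /F /= /g /g0; move: (n.+1%:R^-1) => u; lra.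
pose eta : R := k.+1%:R^-1.
have eta0 : 0 < eta by rewrite invr_gt0.
have bia := bmeas_indic (R := R) ma; have biF := bmeas_indic (R := R) (mF k).
(* Relative to sending everything to [b], a unit of mass sent to [a] costs at least [g0] more, and
   at least [g0 + eta] more if it starts outside [F k]. Mass [l] is sent to [a], and at most
   [pr mu' (F k)] starts inside. *)
have lower pi : coupling mu' nu pi ->
    pot mu' b + (g0 + eta) * l - eta * pr mu' (F k) <=
    \int[pi]_z c (z.1 : X) (z.2 : X).
  move=> cpi.
  have b1 := bmeas1 bb'.
  have b2 := bmeasZ (g0 + eta) (bmeas2 bia).
  have b3 := bmeasZ eta (bmeas1 biF).
  have -> : pot mu' b + (g0 + eta) * l - eta * pr mu' (F k) =
    \int[pi]_z (c b (z.1 : X) + (g0 + eta) * \1_[set a] (z.2 : X)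
                - eta * \1_(F k) (z.1 : X)).
    rewrite RintB//; last exact: bmeasD.
    rewrite RintD// !RintZ//; [|exact: bmeas1|exact: bmeas2].
    rewrite (coupling_Rint1 cpi bb') (coupling_Rint1 cpi biF).
    rewrite (coupling_Rint2 cpi bia) !Rint_indic// (pr_mix1 ab nuE).
    by [].
  pose S : set (borel (X * X)%type) := [set: borel X] `*` ([set a] `|` [set b]).
  apply: (@le_Rint _ (borel (X * X)%type) R pi S).
  - exact: measurable_rectangle.
  - by rewrite (coupling_pr2 cpi)//; exact: pr_mixU nuE.
  - by apply: bmeasB => //; exact: bmeasD.
  - exact: bmeas_cost2.
  move=> [z w] [_ /= [->|->]]; rewrite indic1E ?eqxx ?[b == a]eq_sym ?(negbTE ab).
    rewrite indicE (cost_sym z a); have [zF|zF] := boolP (z \in F k).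
      rewrite !mulr1 addrA addrK -lerBrDl /g0.
      by have [->//|/gz0/ltW] := eqVneq z z0.
    have : ~ F k z by move/mem_set; rewrite (negbTE zF).
    rewrite /F /= => /negP; rewrite -leNgt /g -/eta => h.
    by rewrite mulr1 mulr0 subr0 -lerBrDl.
  rewrite (cost_sym z b) mulr0 addr0 gerBl mulr_ge0 ?(ltW eta0)//.
set m := pr mu [set z0] in lm m1.
have mC : measurable (~` [set z0] : set (borel X)) by exact: measurableC.
have C0 : 0 < pr mu (~` [set z0]) by rewrite prC// subr_gt0.
have [P2' P2'E] := pcond_exists mC C0.
have l1 : 0 < 1 - l by rewrite subr_gt0; exact: le_lt_trans m1.
(* After mass [l] at [z0] is set aside, the remaining mass [1 - l] of [mu] consists of [m - l] at
   [z0] and [1 - m] elsewhere; normalizing gives this weight for [z0] in [P2]. *)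
have l'01 : 0 <= (m - l) / (1 - l) <= 1.
  rewrite divr_ge0 ?subr_ge0 ?(ltW l1)//=; last by rewrite -subr_ge0 ltW.
  by rewrite ler_pdivrMr// mul1r lerD2r ltW.
have [P2 P2E] := pmix_exists (wdirac p1 diam z0) P2' l'01.
have l01 : 0 <= l <= 1 by rewrite ltW//= -subr_ge0 ltW.
have prd x (A : set (borel X)) : measurable A -> pr (wdirac p1 diam x) A = \1_A x.
  exact: pr_wdirac.
have [|A mA|pi cpi piE] := @coupling_split mu nu l (wdirac p1 diam z0) P2
    (wdirac p1 diam a) (wdirac p1 diam b) l01.
- move=> A mA; have -> : pr P2 A = fine (P2 A) by [].
  rewrite P2E//= prd// {2}/pr P2'E//= prC// -/m (pr_split mu mA mz0).
  have -> : pr mu (A `&` [set z0]) = m * \1_A z0.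
    rewrite indicE; have [zA|zA] := boolP (z0 \in A).
      by rewrite (_ : A `&` _ = [set z0]) ?mulr1// setIC set1I zA.
    by rewrite setIC set1I (negbTE zA) pr0 mulr0.
  have l1n : 1 - l != 0 by rewrite gt_eqF.
  have m1n : 1 - m != 0 by rewrite subr_eq0 gt_eqF.
  by field; rewrite l1n m1n.
- by rewrite nuE// !prd.
have := wdist_cost p1 diam (esym E) lower cpi.
suff -> : \int[pi]_z c (z.1 : X) (z.2 : X) = pot mu b + g0 * l.
  have h : 0 < eta * (l - pr mu' (F k)) by rewrite mulr_gt0// subr_gt0.
  by rewrite potE; apply/negP; rewrite -ltNge; lra.
pose S : set (borel (X * X)%type) :=
  ([set z0] `*` [set a]) `|` ([set: borel X] `*` [set b]).
have mS1 : measurable ([set z0] `*` [set a] : set (borel (X * X)%type)).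
  exact: measurable_rectangle.
have mS2 : measurable ([set: borel X] `*` [set b] : set (borel (X * X)%type)).
  exact: measurable_rectangle.
have b1 := bmeas1 bb'.
have b2 := bmeasZ g0 (bmeas2 bia).
rewrite (@eq_Rint _ (borel (X * X)%type) R pi S _
  (fun z : borel (X * X)%type => c b (z.1 : X) + g0 * \1_[set a] (z.2 : X))).
- rewrite RintD// RintZ; last exact: bmeas2.
  rewrite (coupling_Rint1 cpi bb') (coupling_Rint2 cpi bia) !Rint_indic//.
  by rewrite (pr_mix1 ab nuE).
- exact: measurableU.
- rewrite /S prU//; last first.
    by apply/seteqP; split => // -[z w] [[/= _ ->] [_ /= /eqP]]; rewrite (negbTE ab).
  rewrite (coupling_pr2 cpi)// (pr_mix2 ab nuE) piE// !prd// !indic1E !eqxx.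
  rewrite [b == a]eq_sym (negbTE ab) /= !mulr1 !mulr0 addr0.
  by rewrite addrC subrK.
- exact: bmeas_cost2.
- exact: bmeasD.
- move=> [z w] [[/= -> ->]|[_ /= ->]]; rewrite indic1E.
    by rewrite eqxx mulr1 /g0 addrC subrK cost_sym.
  by rewrite [b == a]eq_sym (negbTE ab) mulr0 addr0 cost_sym.
Qed.

End transport.

(** * Approximation by finitely supported measures *)

Section approximation.
Context {R : realType} {X : pmetricType R} {p D : R}.
Hypotheses (p1 : 1 <= p) (diam : forall x y : X, mdist x y <= D).
Hypothesis tb : @totally_bounded_seq R X.
Implicit Types (x y z w : X) (mu nu : wasserstein X p).

Local Notation c x y := (mdist x y `^ p).

Let p0 : 0 < p. Proof. exact: lt_le_trans p1. Qed.

Lemma set_seq_cons x (s : seq X) : [set` x :: s] = [set x] `|` [set` s].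
Proof.
apply/seteqP; split => z /=; rewrite inE; first by move=> /predU1P.
by move=> h; apply/predU1P.
Qed.

Lemma measurable_seq (s : seq X) : measurable ([set` s] : set (borel X)).
Proof.
elim: s => [|x s IH]; first by rewrite set_nil.
rewrite set_seq_cons; apply: measurableU => //; exact: measurable_point.
Qed.

Lemma le_pr_of_atoms mu mu' (s : seq X) (A : set (borel X)) : measurable A ->
  (forall z, pr mu [set z] <= pr mu' [set z]) ->
  pr mu (A `&` [set` s]) <= pr mu' (A `&` [set` s]).
Proof.
move=> + h; elim: s A => [|x s IH] A mA; first by rewrite set_nil setI0 !pr0.
have mx := measurable_point x; have ms := measurable_seq s.
have mxs := measurable_seq (x :: s).
have mAx : measurable (A `&` ~` [set x]).
  by apply: measurableI => //; exact: measurableC.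
have mAxs : measurable (A `&` [set` x :: s]) by exact: measurableI.
rewrite (pr_split mu mAxs mx) (pr_split mu' mAxs mx).
have -> : A `&` [set` x :: s] `&` ~` [set x] = A `&` ~` [set x] `&` [set` s].
  rewrite set_seq_cons setIAC; apply/seteqP; split => z [[Az nz]] //=.
    by case.
  by move=> sz; split => //; right.
apply: lerD; last exact: IH.
rewrite (_ : A `&` [set` x :: s] `&` [set x] = A `&` [set x]); last first.
  by rewrite set_seq_cons -setIA setUK.
by rewrite setIC set1I; case: ifP => _; [exact: h|rewrite !pr0].
Qed.

(** Comparing atoms over the finite support gives [pr mu A <= pr mu' A] for every [A]. The same
    inequality for the complement turns it into an equality, both total masses being 1. *)
Lemma eq_of_atoms mu mu' (s : seq X) : pr mu [set` s] = 1 ->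
  (forall z, pr mu [set z] <= pr mu' [set z]) -> mu = mu'.
Proof.
move=> mus h; have ms := measurable_seq s.
have le A : measurable A -> pr mu A <= pr mu' A.
  move=> mA; rewrite -(prI1 mA ms mus); apply: le_trans (le_pr_of_atoms s mA h) _.
  by apply: le_pr => //; exact: measurableI.
apply: wass_eqP => A mA; apply/eqP; rewrite eq_le le//=.
by have := le _ (measurableC mA); rewrite !prC//; lra.
Qed.

(** This picks the first point of [s] within [e] of [z], not a closest one, and [point] if there is
    none. The first-hit rule makes measurability a direct induction. *)
Fixpoint nearest (e : R) (s : seq X) (z : X) : X :=
  if s is y :: s' then if mdist y z < e then y else nearest e s' z else point.

Lemma measurable_nearest e s :
  measurable_fun setT (nearest e s : borel X -> borel X).
Proof.
elim: s => [|y s IH] /=; first exact: measurable_cst.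
apply: measurable_fun_ifT => //.
apply: measurable_fun_ltr => //.
by apply: continuous_borelR; exact: continuous_mdist.
Qed.

Lemma nearest_mem e s z : nearest e s z \in point :: s.
Proof.
elim: s => [|y s IH] /=; first by rewrite inE.
case: ifP => _; first by rewrite !inE eqxx orbT.
by move: IH; rewrite !inE => /orP[->//|->]; rewrite !orbT.
Qed.

Lemma nearest_lt e s z : (exists2 y, y \in s & mdist y z < e) ->
  mdist (nearest e s z) z < e.
Proof.
elim: s => [[]//|y s IH] [x]; rewrite inE /= => /predU1P[->|xs] xz.
  by rewrite xz.
by case: ifP => // _; apply: IH; exists x.
Qed.

(** The approximating measure is the image of [mu] under [q], and the coupling is its image under
    the graph map of [q]. The radius [r] is chosen so that its [p]-th power is [e]. *)
Lemma finite_approximation mu (e : R) : 0 < e ->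
  exists (nu : wasserstein X p) (s : seq X), pr nu [set` s] = 1 /\
  exists2 pi, coupling mu nu pi & \int[pi]_z c (z.1 : X) (z.2 : X) <= e.
Proof.
move=> e0; pose r := e `^ p^-1; have r0 : 0 < r by rewrite powR_gt0.
have [s sP] := tb r0; pose q := nearest r s : borel X -> borel X.
have mq : measurable_fun setT q by exact: measurable_nearest.
have [P PE] := pimage_exists mu mq.
have mg : measurable_fun setT (fun z : borel X => (z, q z) : borel (X * X)%type).
  apply: (measurableT_comp (measurable_borel_prod tb)).
  exact: measurable_fun_pair.
have [pi piE] := pimage_exists mu mg.
have ms := measurable_seq (point :: s).
exists (towass p1 diam P), (point :: s); split.
  rewrite pr_towass// /pr PE (_ : q @^-1` _ = setT) ?prT//.
    by rewrite -/(pr mu setT) prT.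
  by apply/seteqP; split => // z _; exact: nearest_mem.
have bc := bmeas_cost2 p1 diam.
exists pi.
  split => A mA; rewrite piE; first by congr (mu _); apply/seteqP; split => z //= [].
  by rewrite to_wassersteinE// PE; congr (mu _); apply/seteqP; split => z //= [].
rewrite -(Rint_image mg (fun A mA => esym (piE A)) bc).
rewrite -[leRHS](Rint_cst mu); apply: le_RintT => //.
- exact: (bmeas_comp mg bc).
- exact: bmeas_cst.
move=> z /=; rewrite -[e]powRr1; last exact: ltW.
rewrite -(mulVf (lt0r_neq0 p0)) powRrM ge0_ler_powR ?nnegrE ?mdist_ge0// ?(ltW p0)//.
  exact: powR_ge0.
by rewrite metric_sym; apply: ltW; apply: nearest_lt; exact: sP.
Qed.

Definition fattening (r : R) (F : set X) : set X :=
  [set z | exists2 x, F x & mdist x z < r].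

Lemma open_fattening r F : open (fattening r F).
Proof.
apply/open_mdistP => z [x Fx xz]; exists (r - mdist x z); first by rewrite subr_gt0.
move=> y; rewrite ltrBrDl => h; exists x => //.
exact: le_lt_trans (metric_triangle _ _ _) h.
Qed.

(** A Markov inequality: mass that starts in [F] and ends outside its fattening travels at least [r]
    and pays at least r^p. The coupling may be given in either order, so that the bound can be
    chained through an intermediate measure. *)
Lemma le_pr_fattening mu nu pi (r : R) (F : set X) : 0 < r ->
  measurable (F : set (borel X)) -> coupling mu nu pi \/ coupling nu mu pi ->
  pr mu F <= pr nu (fattening r F) +
    (r `^ p)^-1 * \int[pi]_z c (z.1 : X) (z.2 : X).
Proof.
move=> r0 mF cpi.
have rp0 : 0 < r `^ p by rewrite powR_gt0.
have mFr : measurable (fattening r F : set (borel X)).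
  by apply: measurable_open; exact: open_fattening.
have bc := bmeas_cost2 p1 diam.
have biF := bmeas_indic (R := R) mF; have biFr := bmeas_indic (R := R) mFr.
have key x z : \1_F x <= \1_(fattening r F) z + (r `^ p)^-1 * c x z :> R.
  have c0 : 0 <= (r `^ p)^-1 * c x z by rewrite mulr_ge0 ?invr_ge0 ?powR_ge0.
  rewrite !indicE; have [xF|//] := boolP (x \in F); last first.
    by rewrite addr_ge0.
  have [zF|zF] := boolP (z \in fattening r F); first by rewrite lerDl.
  rewrite add0r mulrC ler_pdivlMr// mul1r.
  rewrite ge0_ler_powR ?nnegrE ?mdist_ge0 ?(ltW p0) ?(ltW r0)//.
  rewrite leNgt; apply/negP => xz; move/negP: zF; apply; rewrite inE.
  by exists x => //; move: xF; rewrite inE.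
rewrite -!Rint_indic//.
case: cpi => cpi.
  rewrite -(coupling_Rint1 cpi biF) -(coupling_Rint2 cpi biFr) -RintZ// -RintD.
  - apply: le_RintT; [exact: bmeas1|by apply: bmeasD; [exact: bmeas2|exact: bmeasZ]|].
    by move=> z; exact: key.
  - exact: bmeas2.
  - exact: bmeasZ.
rewrite -(coupling_Rint2 cpi biF) -(coupling_Rint1 cpi biFr) -RintZ// -RintD.
- apply: le_RintT; [exact: bmeas2|by apply: bmeasD; [exact: bmeas1|exact: bmeasZ]|].
  by move=> z; rewrite (cost_sym z.1 z.2); exact: key.
- exact: bmeas1.
- exact: bmeasZ.
Qed.

(** Going through the common approximation bounds the mass of a closed set [F] by the other
    measure's mass on a twice fattened [F]. These fattenings shrink to [F], so the measures agree on
    closed sets, hence on open sets, which are stable under intersection and generate the Borel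
    sets. *)
Lemma eq_of_common_approximation mu mu' :
  (forall e : R, 0 < e -> exists nu pi pi', [/\ coupling mu nu pi,
    coupling mu' nu pi', \int[pi]_z c (z.1 : X) (z.2 : X) <= e &
    \int[pi']_z c (z.1 : X) (z.2 : X) <= e]) -> mu = mu'.
Proof.
have closed_le nu nu' : (forall e : R, 0 < e ->
      exists nu0 pi pi', [/\ coupling nu nu0 pi, coupling nu' nu0 pi',
        \int[pi]_z c (z.1 : X) (z.2 : X) <= e &
        \int[pi']_z c (z.1 : X) (z.2 : X) <= e]) ->
    forall F : set X, closed F -> pr nu F <= pr nu' F.
  move=> happ F cF; have mF := measurable_closed cF.
  have le_fat r : 0 < r -> pr nu F <= pr nu' (fattening r (fattening r F)).
    move=> r0; apply/ler_addgt0Pr => e e0.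
    have rp0 : 0 < r `^ p by rewrite powR_gt0.
    (* With this cost each of the two fattening inequalities loses at most [e / 2]. *)
    have e'0 : 0 < r `^ p * (e / 2) by rewrite mulr_gt0// divr_gt0.
    have [nu0 [pi [pi' [cpi cpi' Ipi Ipi']]]] := happ _ e'0.
    have mFr : measurable (fattening r F : set (borel X)).
      by apply: measurable_open; exact: open_fattening.
    have h1 := le_pr_fattening r0 mF (or_introl cpi).
    have h2 := le_pr_fattening r0 mFr (or_intror cpi').
    have le2 I : I <= r `^ p * (e / 2) -> (r `^ p)^-1 * I <= e / 2.
      by rewrite ler_pdivrMl.
    by have := le2 _ Ipi; have := le2 _ Ipi'; lra.
  rewrite leNgt; apply/negP => lt.
  pose G k := fattening k.+1%:R^-1 (fattening k.+1%:R^-1 F) : set (borel X).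
  have k0 k : 0 < k.+1%:R^-1 :> R by rewrite invr_gt0.
  have [k] : exists k, pr nu' (G k) < pr nu F.
    apply: pr_bigcap_lt.
    - by move=> k; apply: measurable_open; exact: open_fattening.
    - move=> i j ij; apply/subsetPset => z.
      have ji : j.+1%:R^-1 <= i.+1%:R^-1 :> R by rewrite lef_pV2 ?posrE// ler_nat.
      move=> [y [x Fx xy] yz]; exists y; last exact: lt_le_trans ji.
      by exists x => //; exact: lt_le_trans ji.
    rewrite (_ : \bigcap_n G n = F)//; apply/seteqP; split => z; last first.
      move=> Fz k _; exists z; last by rewrite mdistxx.
      by exists z => //; rewrite mdistxx.
    move=> zG; apply: contrapT => nFz.
    have /open_mdistP/(_ z nFz)[e e0 zF] := closed_openC cF.
    have e20 : 0 < e / 2 by rewrite divr_gt0.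
    have [k] := ltr_add_invr e20; rewrite add0r => ke.
    have [y [x Fx xy] yz] := zG k I.
    apply: (zF x) => //; rewrite metric_sym.
    apply: le_lt_trans (metric_triangle x y z) _; rewrite [ltRHS]splitr.
    by rewrite ltrD// (lt_trans _ ke).
  by apply/negP; rewrite -leNgt; exact: le_fat.
move=> happ.
have eqc F : closed F -> pr mu F = pr mu' F.
  move=> cF; apply/eqP; rewrite eq_le !closed_le// => e e0.
  have [nu0 [pi [pi' [? ? ? ?]]]] := happ _ e0; by exists nu0, pi', pi.
apply: wasserstein_eq => A mA.
apply: (@measure_unique _ R (borel X) (@open X) (fun=> setT) erefl
  _ _ _ mu mu' _ _ A mA).
- by move=> U V oU oV; exact: openI.
- by move=> _; exact: openT.
- by rewrite bigcup_const//; exists 0%N.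
- move=> U oU.
  have mU := measurable_open oU.
  have := eqc _ (open_closedC oU); rewrite !prC// => /(congr1 (fun t => (1 - t)%:E)).
  by rewrite !subKr !EFin_pr.
- by move=> _; rewrite -ge0_fin_numE// fin_num_measure.
Qed.

(** Finitely supported measures are fixed by [eq_of_atoms]. For general [mu], a finitely supported
    [nu] close to [mu] is also close to [Phi mu], since [Phi nu] is [nu]. *)
Lemma isometry_id_of_atoms (Phi : wasserstein X p -> wasserstein X p) :
  (forall mu nu, wdist (Phi mu) (Phi nu) = wdist mu nu) ->
  (forall mu z, pr mu [set z] <= pr (Phi mu) [set z]) ->
  forall mu, Phi mu = mu.
Proof.
move=> PhiI Phia mu; apply/esym/eq_of_common_approximation => e e0.
(* The factor 2 leaves room for the infimum not being attained: if every coupling of [Phi mu] and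
   [nu] cost more than [e], then so much as [e] would be a lower bound for [pi], which costs at most
   [e / 2]. *)
have e20 : 0 < e / 2 by rewrite divr_gt0.
have [nu [s [nus [pi cpi Ipi]]]] := finite_approximation mu e20.
have Pnu : Phi nu = nu by apply/esym/(eq_of_atoms nus).
have [pi' [cpi' Ipi']] : exists pi', coupling (Phi mu) nu pi' /\
    \int[pi']_z c (z.1 : X) (z.2 : X) <= e.
  apply: contrapT => /forallNP h.
  have E : wdist (Phi mu) nu = wdist mu nu by rewrite -{1}Pnu PhiI.
  suff : e <= \int[pi]_z c (z.1 : X) (z.2 : X) by lra.
  apply: (wdist_cost p1 diam E _ cpi) => pi' cpi'.
  by rewrite leNgt; apply/negP => lt; apply: (h pi'); split=> //; exact: ltW.
by exists nu, pi, pi'; split => //; lra.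
Qed.

End approximation.

(** * Reduction to isometries fixing the Dirac masses *)

Section pushforward_isometry.
Context {R : realType} {X : pmetricType R} {p D : R}.
Hypotheses (p1 : 1 <= p) (diam : forall x y : X, mdist x y <= D).
Implicit Types (x y z w : X) (mu nu : wasserstein X p).

Local Notation c x y := (mdist x y `^ p).

Definition is_push (h : X -> X) mu nu := forall A : set (borel X),
  measurable A -> pr nu A = pr mu (h @^-1` A).

Lemma isometry_continuous (h : X -> X) :
  (forall x y, mdist (h x) (h y) = mdist x y) -> continuous h.
Proof.
move=> hi; apply/continuousP => U /open_mdistP oU; apply/open_mdistP => x Ux.
by have [e e0 eU] := oU _ Ux; exists e => // y; rewrite -hi => /eU.
Qed.

Lemma push_exists (h : X -> X) mu :
  (forall x y, mdist (h x) (h y) = mdist x y) -> exists nu, is_push h mu nu.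
Proof.
move=> hi; have mh := continuous_borel (isometry_continuous hi).
have [P PE] := pimage_exists mu mh.
by exists (towass p1 diam P) => A mA; rewrite pr_towass// /pr PE.
Qed.

(** The image of a coupling under the product map of [h] with itself couples the push-forwards at
    the same cost. Equality of the distances follows later by using the inverse isometry as well. *)
Lemma wdist_push_le (h : X -> X) mu nu mu' nu' :
  (forall x y, mdist (h x) (h y) = mdist x y) ->
  is_push h mu mu' -> is_push h nu nu' -> (wdist mu' nu' <= wdist mu nu)%E.
Proof.
move=> hi hmu hnu; have ch := isometry_continuous hi.
have mh := continuous_borel ch.
have mhh : measurable_fun setT
    ((fun u => (h u.1, h u.2)) : borel (X * X)%type -> borel (X * X)%type).
  apply: (@continuous_borel (X * X)%type (X * X)%type) => u.
  apply: cvg_pair.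
    by apply: (@continuous_comp (X * X)%type X X fst h); [exact: cvg_fst|exact: ch].
  by apply: (@continuous_comp (X * X)%type X X snd h); [exact: cvg_snd|exact: ch].
have mpre (A : set (borel X)) : measurable A -> measurable (h @^-1` A : set (borel X)).
  by move=> mA; have := mh measurableT _ mA; rewrite setTI.
have bc := bmeas_cost2 p1 diam.
apply: gt0_ler_poweR; rewrite ?in_itv/= ?leey ?andbT.
- by rewrite invr_ge0; exact: le_trans p1.
- apply: le_ereal_inf_tmp => _ [pi _ <-]; apply: integral_ge0 => z _.
  by rewrite lee_fin powR_ge0.
- apply: le_ereal_inf_tmp => _ [pi _ <-]; apply: integral_ge0 => z _.
  by rewrite lee_fin powR_ge0.
apply: le_ereal_inf_tmp => _ [pi cpi <-].
have [pi' pi'E] := pimage_exists pi mhh.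
apply: ge_ereal_inf.
exists (\int[pi']_(z in [set: borel (X * X)%type]) (c (z.1 : X) (z.2 : X))%:E)%E.
  exists pi' => //; split => A mA; rewrite pi'E.
    rewrite (_ : _ @^-1` _ = (h @^-1` A) `*` setT) ?cpi.1//; last exact: mpre.
      move: (congr1 EFin (hmu A mA)).
      by rewrite EFin_pr// EFin_pr; [move->|exact: mpre].
  rewrite (_ : _ @^-1` _ = setT `*` (h @^-1` A)) ?cpi.2//; last exact: mpre.
    move: (congr1 EFin (hnu A mA)).
    by rewrite EFin_pr// EFin_pr; [move->|exact: mpre].
rewrite -!EFin_Rint// lee_fin -(Rint_image mhh (fun A mA => esym (pi'E A)) bc).
by rewrite le_eqVlt; apply/orP; left; apply/eqP/eq_Rintegral => u _ /=; rewrite hi.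
Qed.

End pushforward_isometry.

Section reduction.
Context {R : realType} {X : pmetricType R} {p D : R}.
Hypotheses (p1 : 1 <= p) (diam : forall x y : X, mdist x y <= D).
Hypothesis tb : @totally_bounded_seq R X.
Variable anti : X -> X.
Hypothesis antiD : forall x, mdist x (anti x) = D.
Hypothesis antiP : forall x y, mdist x y = D -> y = anti x.
Implicit Types (x y z w : X) (mu nu : wasserstein X p).

Local Notation delta := (wdirac p1 diam).

(** The Dirac masses at [x] and [anti x] realize the diameter, and so do their images. By
    [diam_wdist_section] the image of the first is carried by the points at distance [D] from some
    [z], and [anti z] is the only such point. *)
Lemma isometry_wdirac (Phi : wasserstein X p -> wasserstein X p) :
  (forall mu nu, wdist (Phi mu) (Phi nu) = wdist mu nu) ->
  forall x, exists y, Phi (delta x) = delta y.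
Proof.
move=> PhiI x; have E := esym (PhiI (delta (anti x)) (delta x)).
have axD : mdist (anti x) x = D by rewrite metric_sym.
have [z zE] := diam_wdist_section tb axD E.
exists (anti z); apply: eq_wdirac.
have mb : measurable ([set w | mdist z w < D] : set (borel X)).
  by apply: measurable_open; exact: open_mdist_lt.
have := prC (Phi (delta x)) mb; rewrite zE subr0 => <-; congr pr.
apply/seteqP; split => w /=; first by move=> ->; rewrite antiD ltxx.
by move=> /negP; rewrite -leNgt => h; apply: antiP; apply/eqP; rewrite eq_le diam.
Qed.

(** The action of [Phi] on Dirac masses defines an isometry [psi], whose inverse [phi] comes from
    the inverse of [Phi]. Following [Phi] by the push-forward under [phi] gives an isometry that
    fixes all Dirac masses, to which the hypothesis applies. *)
Lemma rigid_of_dirac_fixing :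
  (forall Phi : wasserstein X p -> wasserstein X p,
    (forall mu nu, wdist (Phi mu) (Phi nu) = wdist mu nu) ->
    (forall x, Phi (delta x) = delta x) -> forall mu, Phi mu = mu) ->
  isometrically_rigid X p.
Proof.
move=> fixid Phi [[Psi PhiK PsiK] PhiI].
have PsiI mu nu : wdist (Psi mu) (Psi nu) = wdist mu nu.
  by rewrite -PhiI !PsiK.
have /choice[psi psiE] := isometry_wdirac PhiI.
have /choice[phi phiE] := isometry_wdirac PsiI.
have delta_inj x y : delta x = delta y -> x = y.
  move=> xy; have : wdist (delta x) (delta y) = wdist (delta x) (delta x) by rewrite xy.
  by move/(wdirac_dist_inj tb); rewrite mdistxx => /mdist_positivity.
have psiK : cancel psi phi.
  by move=> x; apply: delta_inj; rewrite -phiE -psiE PhiK.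
have phiK : cancel phi psi.
  by move=> x; apply: delta_inj; rewrite -psiE -phiE PsiK.
have psiI x y : mdist (psi x) (psi y) = mdist x y.
  by have := PhiI (delta x) (delta y); rewrite !psiE; exact: (wdirac_dist_inj tb).
have phiI x y : mdist (phi x) (phi y) = mdist x y.
  by rewrite -psiI !phiK.
exists psi; first by split => //; exists phi.
move=> mu A mA.
have /choice[push pushE] := fun nu => push_exists p1 diam nu phiI.
have mpsi (B : set (borel X)) :
    measurable B -> measurable (psi @^-1` B : set (borel X)).
  move=> mB; have := continuous_borel (isometry_continuous psiI).
  by move=> /(_ measurableT _ mB); rewrite setTI.
have mphi (B : set (borel X)) :
    measurable B -> measurable (phi @^-1` B : set (borel X)).
  move=> mB; have := continuous_borel (isometry_continuous phiI).
  by move=> /(_ measurableT _ mB); rewrite setTI.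
(* Since [nu] is in turn the push-forward of [push nu] under [psi], [wdist_push_le] yields both
   inequalities between the distances. *)
have pushV nu : is_push psi (push nu) nu.
  move=> B mB; rewrite pushE; last exact: mpsi.
  by congr pr; apply/seteqP; split => z /=; rewrite phiK.
have pushI nu nu' : wdist (push nu) (push nu') = wdist nu nu'.
  apply/eqP; rewrite eq_le (wdist_push_le p1 diam phiI (pushE _) (pushE _)).
  exact: (wdist_push_le p1 diam psiI (pushV _) (pushV _)).
have := fixid (push \o Phi) (fun nu nu' => etrans (pushI _ _) (PhiI _ _)).
have h x : push (Phi (delta x)) = delta x.
  rewrite psiE; apply: wass_eqP => B mB; rewrite pushE// !pr_wdirac//; last exact: mphi.
  rewrite !indicE; congr (_ %:R); congr nat_of_bool.
  by apply/idP/idP; rewrite !inE /= psiK.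
move=> /(_ h mu) /= {}h.
rewrite /pushforward -[RHS]EFin_pr; last exact: mpsi.
rewrite -[in RHS]h pushE; last exact: mpsi.
rewrite -[LHS]EFin_pr//; congr (EFin (pr _ _)).
by apply/seteqP; split => z /=; rewrite phiK.
Qed.

End reduction.

(** * Geometry of the torus *)

Section powR_inequalities.
Context {R : realType}.
Implicit Types p q t u v x y : R.

Lemma powR_convex p t x y : 1 <= p -> 0 <= t <= 1 -> 0 <= x -> 0 <= y ->
  ((1 - t) * x + t * y) `^ p <= (1 - t) * x `^ p + t * y `^ p.
Proof.
move=> p1 /andP[t0 t1] x0 y0.
have := convex_powR p1 (Itv01 t0 t1) (x := y) (y := x).
have E a b : conv (Itv01 t0 t1) (a : R^o) b = t * a + (1 - t) * b :> R.
  by rewrite convRE.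
rewrite !inE /= !in_itv /= !andbT => /(_ y0 x0).
by rewrite !E (addrC ((1 - t) * x)) (addrC ((1 - t) * x `^ p)).
Qed.

Lemma powR_exp x q : 0 < x -> x `^ q = expR (q * ln x).
Proof. by move=> x0; rewrite /powR gt_eqF. Qed.

Lemma powR_lt1 q t : q < 1 -> 0 < t < 1 -> t < t `^ q.
Proof.
move=> q1 /andP[t0 t1]; rewrite powR_exp// -[ltLHS]lnK// ltr_expR.
by rewrite -[ltLHS]mul1r ltr_nM2r// ln_lt0// t0.
Qed.

Lemma powR_gt1 q t : 1 < q -> 0 < t < 1 -> t `^ q < t.
Proof.
move=> q1 /andP[t0 t1]; rewrite powR_exp// -[ltRHS]lnK// ltr_expR.
by rewrite -[ltRHS]mul1r ltr_nM2r// ln_lt0// t0.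
Qed.

(** Dividing by [u + v] leaves two fractions in (0, 1) with sum 1, and each is strictly increased by
    the power [q < 1]. For [q > 1] each is decreased, which gives the reverse inequality. *)
Lemma powR_strict_subadd q u v : q < 1 -> 0 < u -> 0 < v ->
  (u + v) `^ q < u `^ q + v `^ q.
Proof.
move=> q1 u0 v0; have w0 : 0 < u + v by rewrite addr_gt0.
have in01 (a b : R) : 0 < a -> 0 < b -> 0 < a / (a + b) < 1.
  by move=> a0 b0; rewrite divr_gt0 ?addr_gt0//= ltr_pdivrMr ?addr_gt0// mul1r ltrDl.
have h1 := powR_lt1 q1 (in01 _ _ u0 v0).
have h2 := powR_lt1 q1 (in01 _ _ v0 u0).
rewrite [v + u]addrC in h2.
have E a : 0 <= a -> a `^ q = (u + v) `^ q * (a / (u + v)) `^ q.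
  by move=> a0; rewrite -powRM ?divr_ge0 ?(ltW w0)// mulrC divfK// gt_eqF.
rewrite (E u) ?(ltW u0)// (E v) ?(ltW v0)// -mulrDr ltr_pMr ?powR_gt0//.
by rewrite (_ : 1 = u / (u + v) + v / (u + v)) ?ltrD// -mulrDl divff// gt_eqF.
Qed.

Lemma powR_strict_superadd q u v : 1 < q -> 0 < u -> 0 < v ->
  u `^ q + v `^ q < (u + v) `^ q.
Proof.
move=> q1 u0 v0; have w0 : 0 < u + v by rewrite addr_gt0.
have in01 (a b : R) : 0 < a -> 0 < b -> 0 < a / (a + b) < 1.
  by move=> a0 b0; rewrite divr_gt0 ?addr_gt0//= ltr_pdivrMr ?addr_gt0// mul1r ltrDl.
have h1 := powR_gt1 q1 (in01 _ _ u0 v0).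
have h2 := powR_gt1 q1 (in01 _ _ v0 u0).
rewrite [v + u]addrC in h2.
have E a : 0 <= a -> a `^ q = (u + v) `^ q * (a / (u + v)) `^ q.
  by move=> a0; rewrite -powRM ?divr_ge0 ?(ltW w0)// mulrC divfK// gt_eqF.
rewrite (E u) ?(ltW u0)// (E v) ?(ltW v0)// -mulrDr gtr_pMr ?powR_gt0//.
by rewrite (_ : 1 = u / (u + v) + v / (u + v)) ?ltrD// -mulrDl divff// gt_eqF.
Qed.

(* With [A = sqrt C] and [B = sqrt (C + 1/4)], the square root of [s^2 + C] lies
   strictly below the chord [(1 - 2s) A + 2s B], and [u |-> u^p] is convex. *)
Lemma powR_half_convex p (C s : R) : 1 <= p -> 0 < C -> 0 < s < 2^-1 ->
  (s ^+ 2 + C) `^ (p / 2) <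
  (1 - 2 * s) * C `^ (p / 2) + 2 * s * (C + 4^-1) `^ (p / 2).
Proof.
move=> p1 C0 /andP[s0 s1].
have p0 : 0 < p by exact: lt_le_trans p1.
have C4 : 0 < C + 4^-1 by rewrite addr_gt0.
have E u : 0 <= u -> u `^ (p / 2) = (Num.sqrt u) `^ p.
  by move=> u0; rewrite mulrC powRrM powR12_sqrt.
have sC0 : 0 <= s ^+ 2 + C by rewrite addr_ge0 ?sqr_ge0// ltW.
rewrite !E ?(ltW C0) ?(ltW C4)//.
set A := Num.sqrt C; set B := Num.sqrt (C + 4^-1).
have A0 : 0 < A by rewrite sqrtr_gt0.
have AB : A < B by rewrite ltr_sqrt// ltrDl.
have A2 : A ^+ 2 = C by rewrite sqr_sqrtr// ltW.
have B2 : B ^+ 2 = C + 4^-1 by rewrite sqr_sqrtr// ltW.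
have m0 : 0 <= (1 - 2 * s) * A + 2 * s * B.
  by rewrite addr_ge0// mulr_ge0 ?sqrtr_ge0//; lra.
apply: lt_le_trans (powR_convex p1 _ (ltW A0) (sqrtr_ge0 _)); last first.
  by apply/andP; split; lra.
rewrite gt0_ltr_powR ?nnegrE ?sqrtr_ge0//.
rewrite -[ltRHS]ger0_norm// -sqrtr_sqr ltr_sqrt; last first.
  rewrite exprn_gt0// ltr_wpDl// ?mulr_ge0 ?mulr_gt0 ?sqrtr_ge0//; try lra.
  exact: lt_trans AB.
rewrite -subr_gt0.
have -> : ((1 - 2 * s) * A + 2 * s * B) ^+ 2 - (s ^+ 2 + C) =
  2 * (2 * s) * (1 - 2 * s) * A * (B - A) +
  ((1 - 2 * s) ^+ 2 + 2 * (2 * s) * (1 - 2 * s)) * A ^+ 2 +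
  (2 * s) ^+ 2 * B ^+ 2 - (s ^+ 2 + C).
  by ring.
rewrite A2 B2.
have -> : 2 * (2 * s) * (1 - 2 * s) * A * (B - A) +
    ((1 - 2 * s) ^+ 2 + 2 * (2 * s) * (1 - 2 * s)) * C +
    (2 * s) ^+ 2 * (C + 4^-1) - (s ^+ 2 + C) = 2 * (2 * s) * (1 - 2 * s) * A * (B - A).
  by field.
by rewrite !mulr_gt0// ?subr_gt0//; lra.
Qed.

End powR_inequalities.

(** * Coordinate distances, half-shifts and antipodes *)

Section torus_geometry.
Context {R : realType} {n : nat}.
Implicit Types (x y z w : torus R n) (k : 'I_n) (b : pred 'I_n).

Lemma mod1_id (t : R) : - 2^-1 <= t < 2^-1 -> mod1 t = t.
Proof.
move=> /andP[t1 t2]; rewrite /mod1 (_ : Num.floor _ = 0) ?subr0//.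
by apply: floor_def; rewrite add0r; apply/andP; split; lra.
Qed.

Lemma mod1Dz (t : R) (m : int) : mod1 (t + m%:~R) = mod1 t.
Proof.
rewrite /mod1 (_ : t + m%:~R + 2^-1 = t + 2^-1 + m%:~R); last by ring.
by rewrite floorDrz ?intr_int// intrKfloor intrD; ring.
Qed.

Lemma mod1_bounds (t : R) : - 2^-1 <= mod1 t < 2^-1.
Proof. by have := mod1_itv t; rewrite in_itv. Qed.

Lemma mod1_le (t : R) : `|mod1 t| <= 2^-1.
Proof. by have /andP[? ?] := mod1_bounds t; rewrite ler_norml; lra. Qed.

Lemma mod1_half (t : R) : `|mod1 (t + 2^-1)| = 2^-1 - `|mod1 t|.
Proof.
have -> : t + 2^-1 = mod1 t + 2^-1 + (Num.floor (t + 2^-1))%:~R.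
  by rewrite /mod1; ring.
rewrite mod1Dz; have /andP[h1 h2] := mod1_bounds t.
have [v0|v0] := ltP (mod1 t) 0.
  rewrite mod1_id; last by apply/andP; split; lra.
  by rewrite ger0_norm ?ltr0_norm//; lra.
have -> : mod1 t + 2^-1 = mod1 t - 2^-1 + 1%:~R by field.
rewrite mod1Dz mod1_id; last by apply/andP; split; lra.
by rewrite ler0_norm ?ger0_norm//; lra.
Qed.

Definition tcoord x z k : R := `|mod1 (x 0 k - z 0 k)|.

Lemma tcoord_ge0 x z k : 0 <= tcoord x z k.
Proof. exact: normr_ge0. Qed.

Lemma tcoord_le x z k : tcoord x z k <= 2^-1.
Proof. exact: mod1_le. Qed.

Lemma tcoord_sym x z k : tcoord x z k = tcoord z x k.
Proof. by rewrite /tcoord -mod1N opprB. Qed.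

Lemma tcoord_triangle y x z k : tcoord x z k <= tcoord x y k + tcoord y z k.
Proof. by rewrite /tcoord; apply: le_trans (mod1D _ _); rewrite addrA subrK. Qed.

Lemma tcoordxx x k : tcoord x x k = 0.
Proof. by rewrite /tcoord subrr mod1_id ?normr0//; apply/andP; split; lra. Qed.

Lemma torus_bounds x k : - 2^-1 <= x 0 k < 2^-1.
Proof. by case: x => v /= /forallP/(_ k); rewrite in_itv. Qed.

Definition sqdist x z : R := \sum_k tcoord x z k ^+ 2.

Lemma mdistE x z : mdist x z = Num.sqrt (sqdist x z).
Proof. by []. Qed.

Lemma sqdist_ge0 x z : 0 <= sqdist x z.
Proof. by apply: sumr_ge0 => k _; exact: sqr_ge0. Qed.

Lemma sqdist_gt0 x z : (0 < sqdist x z) = (z != x).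
Proof. by rewrite eq_sym -mdist_gt0 mdistE sqrtr_gt0. Qed.

Lemma powR_mdist x z (p : R) : mdist x z `^ p = sqdist x z `^ (p / 2).
Proof. by rewrite mdistE -powR12_sqrt ?sqdist_ge0// -powRrM mulrC. Qed.

Lemma eq_torus x z : (forall k, tcoord x z k = 0) -> z = x.
Proof.
move=> h; apply/esym/torus_dist_eq0; rewrite -[LHS]/(mdist x z) mdistE /sqdist.
by rewrite big1 ?sqrtr0// => k _; rewrite h expr0n.
Qed.

(** The sign test selects the representative of x_k + 1/2 that lies in [-1/2, 1/2). *)
Definition half_shift_row b x : 'rV[R]_n :=
  \row_k (if b k then (if x 0 k < 0 then x 0 k + 2^-1 else x 0 k - 2^-1)
          else x 0 k).

Fact half_shift_subproof b x :
  [forall k, half_shift_row b x 0 k \in `[- 2^-1, 2^-1[ ].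
Proof.
apply/forallP => k; rewrite mxE in_itv /=; have /andP[h1 h2] := torus_bounds x k.
by case: ifP => _; [case: ltP => h|]; apply/andP; split; lra.
Qed.

Definition half_shift b x : torus R n := Torus (half_shift_subproof b x).

Lemma tcoord_half_shift b x z k : tcoord (half_shift b x) z k =
  if b k then 2^-1 - tcoord x z k else tcoord x z k.
Proof.
rewrite /tcoord /= mxE; case: ifP => // _; case: ifP => _.
  by rewrite addrAC mod1_half.
rewrite addrAC (_ : _ - 2^-1 = x 0 k - z 0 k + 2^-1 + (- 1)%:~R); last by field.
by rewrite mod1Dz mod1_half.
Qed.

Lemma half_shift_neq b x k : b k -> half_shift b x != x.
Proof.
move=> bk; apply/eqP => E; have := tcoord_half_shift b x x k.
by rewrite E bk tcoordxx subr0 => /eqP; rewrite eq_sym invr_eq0 pnatr_eq0.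
Qed.

Lemma eq_half_shift b x z :
  (forall k, tcoord x z k = if b k then 2^-1 else 0) -> z = half_shift b x.
Proof.
move=> h; apply: eq_torus => k; rewrite tcoord_half_shift h.
by case: (b k); rewrite ?subrr.
Qed.

Lemma half_shiftK b : involutive (half_shift b).
Proof.
move=> x; apply/esym/eq_half_shift => k.
by rewrite tcoord_half_shift tcoordxx subr0.
Qed.

Lemma sqdist_half_shift b x : sqdist x (half_shift b x) = #|b|%:R / 4.
Proof.
rewrite /sqdist (eq_bigr (fun k => if b k then 4^-1 else 0)).
  by rewrite -big_mkcond/= sumr_const mulr_natl.
move=> k _; rewrite tcoord_sym tcoord_half_shift tcoordxx.
by case: ifP => _; rewrite ?expr0n// subr0; field.
Qed.

Definition anti x := half_shift predT x.

Definition torus_diam : R := Num.sqrt (n%:R / 4).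

Lemma sqdist_le x z : sqdist x z <= n%:R / 4.
Proof.
have -> : n%:R / 4 = \sum_(k < n) 4^-1 :> R.
  by rewrite sumr_const card_ord mulr_natl.
apply: ler_sum => k _; have := tcoord_le x z k; have := tcoord_ge0 x z k.
by nra.
Qed.

Lemma torus_diamP x z : mdist x z <= torus_diam.
Proof. by rewrite mdistE ler_sqrt ?sqdist_le// divr_ge0. Qed.

Lemma mdist_anti x : mdist x (anti x) = torus_diam.
Proof. by rewrite mdistE sqdist_half_shift cardT size_enum_ord. Qed.

Lemma sqdist_anti x z : sqdist (anti x) z = \sum_k (2^-1 - tcoord x z k) ^+ 2.
Proof. by apply: eq_bigr => k _; rewrite tcoord_half_shift. Qed.

(** Coordinate distances are at most 1/2, so the nonnegative differences between 1/4 and their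
    squares sum to zero only if every one of them vanishes. *)
Lemma mdist_antiP x z : mdist x z = torus_diam -> z = anti x.
Proof.
move=> /eqP; rewrite mdistE eqr_sqrt ?sqdist_ge0 ?divr_ge0// => /eqP E.
apply: eq_half_shift => k /=.
have : \sum_k (4^-1 - tcoord x z k ^+ 2) = 0.
  by rewrite sumrB -/(sqdist x z) E sumr_const card_ord mulr_natl subrr.
have h k' : 0 <= 4^-1 - tcoord x z k' ^+ 2.
  by have := tcoord_le x z k'; have := tcoord_ge0 x z k'; nra.
move=> /eqP; rewrite psumr_eq0// => /allP/(_ k).
rewrite mem_index_enum => /(_ isT) /eqP.
by have := tcoord_le x z k; have := tcoord_ge0 x z k; nra.
Qed.

(** In one coordinate, t^2 + (1/2 - t)^2 = 1/4 - 2t(1/2 - t). The subtracted sum is nonnegative and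
    vanishes exactly when every coordinate distance is 0 or 1/2. *)
Lemma sqdist_add_anti x z : sqdist x z + sqdist (anti x) z =
  n%:R / 4 - \sum_k 2 * (tcoord x z k * (2^-1 - tcoord x z k)).
Proof.
have -> : n%:R / 4 = \sum_(k < n) 4^-1 :> R.
  by rewrite sumr_const card_ord mulr_natl.
rewrite sqdist_anti /sqdist -big_split -sumrB/=; apply: eq_bigr => k _.
by field.
Qed.

Lemma torus_totally_bounded : @totally_bounded_seq R (torus R n).
Proof.
move=> e e0.
(* On a grid of mesh 1/(N+1) each coordinate distance t to the chosen point is at most 1/(N+1), and
   t^2 <= t, so the squared distance is at most n/(N+1). Dividing by [n.+1] keeps the denominator
   positive when [n] is 0. *)
have e20 : 0 < e ^+ 2 / (n.+1)%:R by rewrite divr_gt0// exprn_gt0.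
have [N] := ltr_add_invr e20; rewrite add0r => Ne.
pose f (g : {ffun 'I_n -> 'I_N.+1}) : 'rV[R]_n :=
  \row_k (- 2^-1 + (g k)%:R / N.+1%:R).
have fP g : [forall k, f g 0 k \in `[- 2^-1, 2^-1[ ].
  apply/forallP => k; rewrite mxE in_itv /= lerDl divr_ge0//=.
  have : (g k)%:R / N.+1%:R < 1 :> R by rewrite ltr_pdivrMr// mul1r ltr_nat.
  by move: (_ / _ : R) => u; lra.
exists [seq Torus (fP g) | g <- enum {ffun 'I_n -> 'I_N.+1}] => x.
have N0 : 0 < N.+1%:R :> R by [].
pose h k := Num.truncn ((x 0 k + 2^-1) * N.+1%:R).
have x0 k : 0 <= (x 0 k + 2^-1) * N.+1%:R.
  by rewrite mulr_ge0//; have /andP[] := torus_bounds x k; lra.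
have hN k : (h k < N.+1)%N.
  rewrite truncn_lt_nat// gtr_pMl//; have /andP[] := torus_bounds x k; lra.
pose g := [ffun k => Ordinal (hN k)].
exists (Torus (fP g)); first by apply: map_f; rewrite mem_enum.
have dk k : tcoord (Torus (fP g)) x k <= N.+1%:R^-1.
  rewrite /tcoord; apply: le_trans (mod1_min _ 0) _; rewrite subr0 /= mxE ffunE /=.
  have h1 : (h k)%:R <= (x 0 k + 2^-1) * N.+1%:R by rewrite truncn_le.
  have h2 := truncnS_gt ((x 0 k + 2^-1) * N.+1%:R).
  rewrite -/(h k) in h2.
  have h3 : (h k)%:R / N.+1%:R <= x 0 k + 2^-1 by rewrite ler_pdivrMr.
  have h4 : x 0 k + 2^-1 < (h k)%:R / N.+1%:R + N.+1%:R^-1.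
    by rewrite -[X in _ < _ + X]mul1r -mulrDl ltr_pdivlMr// natr1.
  move: h3 h4; move: ((h k)%:R / N.+1%:R) => a.
  move: (N.+1%:R^-1 : R) => d h3 h4.
  by rewrite distrC ger0_norm; lra.
rewrite mdistE -[e]ger0_norm ?(ltW e0)// -sqrtr_sqr ltr_sqrt ?exprn_gt0//.
apply: (@le_lt_trans _ _ (n%:R * N.+1%:R^-1)).
  rewrite mulr_natl -[X in _ *+ X]card_ord -sumr_const; apply: ler_sum => k _.
  apply: le_trans (dk k).
  by have := tcoord_le (Torus (fP g)) x k; have := tcoord_ge0 (Torus (fP g)) x k; nra.
apply: (@le_lt_trans _ _ (n.+1%:R * N.+1%:R^-1)).
  by rewrite ler_wpM2r ?invr_ge0// ler_nat.
by rewrite mulrC -ltr_pdivlMr.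
Qed.

End torus_geometry.

(** * The quadratic cost *)

Section quadratic_cost.
Context {R : realType} {n : nat}.
Local Notation X := (torus R n).
Implicit Types (x y z w : X) (k i j : 'I_n) (mu nu : wasserstein X (2 : R)) (l : R).

Local Notation c x y := (mdist x y `^ 2).

Let p1 : (1 : R) <= 2. Proof. by rewrite ler1n. Qed.
Let diam := @torus_diamP R n.
Let tb := @torus_totally_bounded R n.

Lemma sqdistE x z : c x z = sqdist x z.
Proof. by rewrite powR_mdist divff// powRr1// sqdist_ge0. Qed.

Lemma sqdist_half_shift1 x z k :
  sqdist (half_shift (pred1 k) x) z = sqdist x z + 4^-1 - tcoord x z k.
Proof.
rewrite /sqdist (bigD1 k)//= [in RHS](bigD1 k)//= tcoord_half_shift /= eqxx.
rewrite (eq_bigr (fun m => tcoord x z m ^+ 2)); first by field.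
by move=> m /negbTE mk; rewrite tcoord_half_shift /= mk.
Qed.

Let bc x : bmeas (fun z : borel X => c x (z : X)) := bmeas_cost p1 diam x.

(** The half-shift of one coordinate changes the squared distance by an affine function of the
    coordinate distance. Hence the mean of the latter can be read from two potentials. *)
Lemma tcoordE x z k :
  tcoord x z k = c x z + 4^-1 - c (half_shift (pred1 k) x) z.
Proof. by rewrite !sqdistE sqdist_half_shift1; ring. Qed.

Lemma bmeas_tcoord x k : bmeas (fun z : borel X => tcoord x (z : X) k).
Proof.
under eq_fun do rewrite tcoordE.
by apply: bmeasB => //; apply: bmeasD => //; exact: bmeas_cst.
Qed.

Lemma Rint_tcoord mu x k : \int[mu]_z tcoord x (z : X) k =
  pot mu x + 4^-1 - pot mu (half_shift (pred1 k) x).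
Proof.
under eq_Rintegral do rewrite tcoordE.
have b4 : bmeas (fun z : borel X => c x (z : X) + 4^-1).
  by apply: bmeasD => //; exact: bmeas_cst.
rewrite RintB// RintD//; last exact: bmeas_cst.
by rewrite Rint_cst.
Qed.

(** This is the set of the 2^n points [half_shift b x]. *)
Definition cube x : set (borel X) :=
  [set z | forall k, tcoord x (z : X) k = 0 \/ tcoord x (z : X) k = 2^-1].

Definition face x k : set (borel X) := [set z | tcoord x (z : X) k = 0].

Lemma measurable_face x k : measurable (face x k).
Proof.
have := (bmeas_tcoord x k).1 measurableT _ (measurable_set1 0).
by rewrite setTI; exact.
Qed.

Let defect x (z : borel X) : R := n%:R / 4 - (c x (z : X) + c (anti x) (z : X)).

Let bdefect x : bmeas (defect x).
Proof. by apply: bmeasB; [exact: bmeas_cst|exact: bmeasD]. Qed.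

Let tt_ge0 x z k : 0 <= 2 * (tcoord x z k * (2^-1 - tcoord x z k)).
Proof. by rewrite !mulr_ge0 ?tcoord_ge0 ?subr_ge0 ?tcoord_le. Qed.

Let defectE x z :
  defect x z = \sum_k 2 * (tcoord x z k * (2^-1 - tcoord x z k)).
Proof. by rewrite /defect !sqdistE sqdist_add_anti subKr. Qed.

Let cubeC x : ~` cube x = [set z | 0 < defect x z].
Proof.
apply/seteqP; split => z /=; rewrite defectE.
  move=> /existsNP[k /not_orP[/eqP t0 /eqP t1]].
  rewrite lt_neqAle sumr_ge0// andbT eq_sym psumr_eq0//.
  apply/allPn; exists k; first by rewrite mem_index_enum.
  by rewrite /= !mulf_eq0 pnatr_eq0/= (negbTE t0)/= subr_eq0 eq_sym.
move=> + zc; rewrite big1 ?ltxx// => k _.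
by case: (zc k) => ->; rewrite ?mul0r ?subrr ?mulr0.
Qed.

Lemma measurable_cube x : measurable (cube x).
Proof.
rewrite -(setCK (cube x)) cubeC; apply: measurableC.
have := (bdefect x).1 measurableT _ (measurable_itv `]0, +oo[).
by rewrite setTI set_itvE.
Qed.

(** The hypothesis says that [defect x], which is nonnegative and positive exactly off the cube, has
    integral zero. *)
Lemma pr_cube mu x : pot mu x + pot mu (anti x) = n%:R / 4 ->
  pr mu (cube x) = 1.
Proof.
move=> E; have mcu := measurable_cube x.
have If : \int[mu]_z defect x z <= 0.
  rewrite /defect RintB ?RintD//; [|exact: bmeas_cst|exact: bmeasD].
  by rewrite Rint_cst -!/(pot _ _) E subrr.
have f0 z : 0 <= defect x z by rewrite defectE sumr_ge0.
have := Rint_ge0_pr_gt0 (bdefect x) f0 If.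
by rewrite -cubeC prC// => /eqP; rewrite subr_eq0 => /eqP.
Qed.

Lemma Rint_tcoord_face mu x k : pr mu (cube x) = 1 ->
  \int[mu]_z tcoord x (z : X) k = 2^-1 * (1 - pr mu (face x k)).
Proof.
move=> mu1; have mf := measurable_face x k.
have bi := bmeas_indic (R := R) mf.
have b1 : bmeas (fun z : borel X => 1 - \1_(face x k) z : R).
  by apply: bmeasB => //; exact: bmeas_cst.
rewrite (@eq_Rint _ (borel X) R mu (cube x) _
  (fun z => 2^-1 * (1 - \1_(face x k) z)) (measurable_cube x) mu1).
- rewrite RintZ// RintB//; last exact: bmeas_cst.
  by rewrite Rint_cst Rint_indic.
- exact: bmeas_tcoord.
- exact: bmeasZ.
move=> z zc; rewrite indicE; have [zf|zf] := pselect (face x k z).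
  by rewrite mem_set// subrr mulr0.
by rewrite memNset// subr0 mulr1; case: (zc k).
Qed.

Lemma pr_face mu x k : pr mu (cube x) = 1 -> pr mu (face x k) =
  1 - 2 * (pot mu x + 4^-1 - pot mu (half_shift (pred1 k) x)).
Proof. by move=> mu1; rewrite -Rint_tcoord Rint_tcoord_face//; field. Qed.

(** In coordinate [k] the two points agree both with [x] or both with [anti x]; the triangle
    inequality goes through the corresponding point. *)
Lemma cube_tcoord_eq x z w k : cube x z -> cube x w ->
  (face x k z <-> face x k w) -> tcoord z w k = 0.
Proof.
move=> zc wc zw; apply/eqP; rewrite eq_le tcoord_ge0 andbT.
have [zf|zf] := pselect (face x k z).
  apply: le_trans (tcoord_triangle x z w k) _.
  by rewrite tcoord_sym zf (zw.1 zf) addr0.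
have hz : tcoord x z k = 2^-1 by case: (zc k).
have hw : tcoord x w k = 2^-1 by case: (wc k) => // wf; case: zf; exact: zw.2.
apply: le_trans (tcoord_triangle (anti x) z w k) _.
by rewrite tcoord_sym !tcoord_half_shift hz hw subrr addr0.
Qed.

Lemma pr_cond_split l (P : probability (borel X) R) (F : set (borel X)) :
  measurable F -> pr P F = l -> 0 < l < 1 ->
  exists P1 P2 : probability (borel X) R,
  [/\ forall A : set (borel X), measurable A -> l * pr P1 A = pr P (A `&` F),
      forall A : set (borel X), measurable A ->
        (1 - l) * pr P2 A = pr P (A `&` ~` F) &
      forall A : set (borel X), measurable A ->
        pr P A = l * pr P1 A + (1 - l) * pr P2 A].
Proof.
move=> mF Fl /andP[l0 l1]; have mC : measurable (~` F) by exact: measurableC.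
have Cl : pr P (~` F) = 1 - l by rewrite prC// Fl.
have l10 : 0 < 1 - l by rewrite subr_gt0.
have F0 : 0 < pr P F by rewrite Fl.
have C0 : 0 < pr P (~` F) by rewrite Cl.
have [P1 P1E] := pcond_exists mF F0.
have [P2 P2E] := pcond_exists mC C0.
have E1 (A : set (borel X)) : measurable A -> l * pr P1 A = pr P (A `&` F).
  move=> mA; have h := congr1 fine (P1E A mA).
  by rewrite [pr P1 A]h Fl mulVKf// gt_eqF.
have E2 (A : set (borel X)) : measurable A -> (1 - l) * pr P2 A = pr P (A `&` ~` F).
  move=> mA; have h := congr1 fine (P2E A mA).
  by rewrite [pr P2 A]h Cl mulVKf// gt_eqF.
exists P1, P2; split => // A mA.
by rewrite E1// E2//; exact: pr_split.
Qed.

(* Conditionally on the i-th coordinate, the two measures are coupled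
   independently. The cost of this coupling is the lower bound minus a quarter
   of the probability that the j-th coordinates agree, which must then vanish. *)
Lemma face_correlation mu nu x i j l : i != j -> 0 < l < 2^-1 ->
  pr mu (cube x) = 1 -> pr nu (cube x) = 1 ->
  (forall k, pr mu (face x k) = l) -> pr nu (face x i) = l ->
  (forall k, k != i -> k != j -> pr nu (face x k) = 1) ->
  (forall pi, coupling mu nu pi ->
    (n%:R - 2) * (1 - l) / 4 + 4^-1 <= \int[pi]_z c (z.1 : X) (z.2 : X)) ->
  pr mu (face x j `&` ~` face x i) = 0.
Proof.
move=> ij /andP[l0 l2] mu1 nu1 muf nufi nufk lower.
have l1 : 0 < 1 - l by lra.
have l01 : 0 < l < 1 by rewrite l0 -subr_gt0.
have l01' : 0 <= l <= 1 by rewrite !ltW// -subr_gt0.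
have mFi := measurable_face x i; have mFj := measurable_face x j.
have mCi : measurable (~` face x i) by exact: measurableC.
have mCj : measurable (~` face x j) by exact: measurableC.
have [P1 [P2 [P1E P2E muE]]] := pr_cond_split mFi (muf i) l01.
have [Q1 [Q2 [Q1E Q2E nuE]]] := pr_cond_split mFi nufi l01.
have [pi cpi piE] := coupling_split tb l01' muE nuE.
have fix1 (P S : probability (borel X) R) (F : set (borel X)) (t : R) : t != 0 ->
    (forall A : set (borel X), measurable A -> t * pr S A = pr P (A `&` F)) ->
    measurable F -> pr P F = t -> pr S F = 1.
  by move=> t0 SE mF Ft; apply: (mulfI t0); rewrite SE// setIid Ft mulr1.
have l0n : l != 0 by rewrite gt_eqF.
have l1n : 1 - l != 0 by rewrite gt_eqF.
have P1i : pr P1 (face x i) = 1 := fix1 _ _ _ _ l0n P1E mFi (muf i).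
have Q1i : pr Q1 (face x i) = 1 := fix1 _ _ _ _ l0n Q1E mFi nufi.
have muCi : pr mu (~` face x i) = 1 - l by rewrite prC// muf.
have nuCi : pr nu (~` face x i) = 1 - l by rewrite prC// nufi.
have P2i : pr P2 (~` face x i) = 1 := fix1 _ _ _ _ l1n P2E mCi muCi.
have Q2i : pr Q2 (~` face x i) = 1 := fix1 _ _ _ _ l1n Q2E mCi nuCi.
pose sq (F : set (borel X)) : set (borel (X * X)%type) := F `*` F.
pose same k := sq (face x k) `|` sq (~` face x k).
have msq F : measurable F -> measurable (sq F).
  by move=> mF; exact: measurable_rectangle.
have sq_disj (F : set (borel X)) : sq F `&` sq (~` F) = set0.
  by apply/seteqP; split => // -[z w] [[/= ? _] [/= ? _]].
have mEi : measurable (same i) by apply: measurableU; exact: msq.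
have mEj : measurable (same j) by apply: measurableU; exact: msq.
have samei : pr pi (same i) = 1.
  rewrite /same prU; [|exact: msq|exact: msq|exact: sq_disj].
  rewrite /sq !piE// !prC// P1i Q1i.
  have -> : pr P2 (face x i) = 0 by move: P2i; rewrite prC//; lra.
  have -> : pr Q2 (face x i) = 0 by move: Q2i; rewrite prC//; lra.
  by ring.
pose S := (sq (cube x)) `&` same i.
have mcu := measurable_cube x.
have mS : measurable S by apply: measurableI => //; exact: msq.
have S1 : pr pi S = 1.
  rewrite /S prI1//; last exact: msq.
  rewrite (_ : sq (cube x) = (cube x `*` setT) `&` (setT `*` cube x)); last first.
    by apply/seteqP; split => [[z w] [zc wc]|[z w] [[zc _] [_ wc]]]; split.
  have m1 : measurable (cube x `*` [set: borel X] : set (borel (X * X)%type)).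
    exact: measurable_rectangle.
  have m2 : measurable ([set: borel X] `*` cube x : set (borel (X * X)%type)).
    exact: measurable_rectangle.
  by rewrite prI1// ?(coupling_pr1 cpi)// (coupling_pr2 cpi).
have bi : bmeas (\1_(same j) : borel (X * X)%type -> R) by exact: bmeas_indic.
pose K k := (k != i) && (k != j).
(* An upper bound for the cost on [S]. Coordinate [i] contributes 0. For [k] other than [i] and [j],
   a distance t <= 1/2 satisfies t^2 <= t/2, and t is at most the sum of the distances to [x].
   Coordinate [j] contributes 0 on [same j] and at most 1/4 elsewhere. *)
pose H (z : borel (X * X)%type) : R :=
  \sum_(k | K k) 2^-1 * (tcoord x (z.1 : X) k + tcoord x (z.2 : X) k) +
  (4^-1 - 4^-1 * \1_(same j) z).
have b12 k : bmeas (fun z : borel (X * X)%type =>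
    2^-1 * (tcoord x (z.1 : X) k + tcoord x (z.2 : X) k)).
  have bt := bmeas_tcoord x k.
  by apply: bmeasZ; apply: bmeasD; [exact: bmeas1 bt|exact: bmeas2 bt].
have bsum := bmeas_sum (index_enum 'I_n) K b12.
have b4 : bmeas (fun z : borel (X * X)%type => 4^-1 - 4^-1 * \1_(same j) z : R).
  by apply: bmeasB; [exact: bmeas_cst|exact: bmeasZ].
have IH : \int[pi]_z H z = (n%:R - 2) * (1 - l) / 4 + (4^-1 - 4^-1 * pr pi (same j)).
  rewrite /H RintD// Rint_sum// RintB//; [|exact: bmeas_cst|exact: bmeasZ].
  rewrite Rint_cst RintZ// Rint_indic//; congr (_ + _).
  rewrite (eq_bigr (fun=> 4^-1 * (1 - l))).
    have : \sum_(k < n) 4^-1 * (1 - l) = n%:R * (4^-1 * (1 - l)).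
      by rewrite sumr_const card_ord mulr_natl.
    rewrite (bigD1 i)//= (bigD1 j)/=; last by rewrite eq_sym.
    move=> h; rewrite [LHS](_ : _ = n%:R * (4^-1 * (1 - l)) -
      2 * (4^-1 * (1 - l))); [by field|by rewrite -h; ring].
  move=> k /andP[ki kj].
  have bt := bmeas_tcoord x k.
  rewrite RintZ; last by apply: bmeasD; [exact: bmeas1 bt|exact: bmeas2 bt].
  rewrite RintD; [|exact: bmeas1 bt|exact: bmeas2 bt].
  rewrite (coupling_Rint1 cpi bt) (coupling_Rint2 cpi bt) !Rint_tcoord_face//.
  by rewrite muf nufk//; field.
have cH : \int[pi]_z c (z.1 : X) (z.2 : X) <= \int[pi]_z H z.
  apply: (le_Rint mS S1); [exact: bmeas_cost2|exact: bmeasD|].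
  move=> [z w] [[/= zc wc] zwi]; rewrite sqdistE /sqdist /H /=.
  have tij : tcoord z w i = 0.
    by apply: (cube_tcoord_eq zc wc); case: zwi => -[].
  rewrite (bigD1 i)//= tij expr0n/= add0r (bigD1 j)/=; last by rewrite eq_sym.
  rewrite addrC; apply: lerD.
    apply: ler_sum => k _; have h1 := tcoord_ge0 z w k; have h2 := tcoord_le z w k.
    have := tcoord_triangle x z w k; rewrite (tcoord_sym z x).
    by nra.
  rewrite indicE; have [zwj|zwj] := pselect (same j (z, w)).
    rewrite mem_set// (cube_tcoord_eq zc wc) ?expr0n/= ?mulr1 ?subrr//.
    by case: zwj => -[].
  rewrite memNset// mulr0 subr0.
  by have := tcoord_ge0 z w j; have := tcoord_le z w j; nra.
have Ej0 : pr pi (same j) <= 0.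
  by have := le_trans (lower pi cpi) cH; rewrite IH; lra.
move: Ej0; rewrite /same prU; [|exact: msq|exact: msq|exact: sq_disj].
rewrite /sq !piE//.
have ge0 (P : probability (borel X) R) A : 0 <= pr P A by exact: pr_ge0.
have mul0 (a1 a2 a3 a4 : R) : 0 <= a1 -> 0 <= a2 -> 0 <= a3 -> 0 <= a4 ->
    l * a1 + (1 - l) * a2 + (l * a3 + (1 - l) * a4) <= 0 -> a2 = 0 /\ a4 = 0.
  move=> h1 h2 h3 h4 h; have g1 : 0 <= l * a1 by rewrite mulr_ge0// ltW.
  have g2 : 0 <= (1 - l) * a2 by rewrite mulr_ge0// ltW.
  have g3 : 0 <= l * a3 by rewrite mulr_ge0// ltW.
  have g4 : 0 <= (1 - l) * a4 by rewrite mulr_ge0// ltW.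
  have e2 : (1 - l) * a2 = 0 by lra.
  have e4 : (1 - l) * a4 = 0 by lra.
  by split; apply: (mulfI l1n); rewrite mulr0.
move=> /mul0[]; try exact: mulr_ge0.
move=> hj hCj.
(* As [l < 1 - l], the mass [l] of face [j] is too small for [P2] to be carried by it. So [P2]
   charges its complement, [hCj] puts [Q2] entirely on the face, and [hj] then says that [P2] does
   not charge the face. *)
have muj : pr mu (face x j `&` ~` face x i) <= l.
  rewrite -(muf j); apply: le_pr => //; exact: measurableI.
have P2C : pr P2 (~` face x j) != 0.
  apply/eqP => P20; have := P2E _ mFj; have := prC P2 mFj; rewrite P20.
  by move=> h1 h2; move: muj; rewrite -h2 (_ : pr P2 (face x j) = 1); lra.
have Q2C : pr Q2 (~` face x j) = 0.
  by move/eqP: hCj; rewrite mulf_eq0 (negbTE P2C) => /eqP.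
have Q2j : pr Q2 (face x j) = 1 by move: Q2C; rewrite prC//; lra.
by rewrite -P2E//; move: hj; rewrite Q2j mulr1 => ->; rewrite mulr0.
Qed.

End quadratic_cost.

(** * Isometries fixing the Dirac masses *)

Section dirac_fixing.
Context {R : realType} {X : pmetricType R} {p D : R}.
Hypotheses (p1 : 1 <= p) (diam : forall x y : X, mdist x y <= D).
Hypothesis tb : @totally_bounded_seq R X.
Variable Phi : wasserstein X p -> wasserstein X p.
Hypothesis PhiI : forall mu nu, wdist (Phi mu) (Phi nu) = wdist mu nu.
Hypothesis Phid : forall x, Phi (wdirac p1 diam x) = wdirac p1 diam x.
Implicit Types (x y z a b : X) (mu nu : wasserstein X p) (l : R).

Local Notation c x y := (mdist x y `^ p).

Lemma pot_fixing mu y : pot (Phi mu) y = pot mu y.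
Proof. by apply: (pot_eq (p1 := p1) (diam := diam) tb); rewrite -{1}Phid PhiI. Qed.

(** If the mass at [z] dropped, [mix_detect] with a weight [l] strictly between the two masses would
    contradict the drop, because the mixture with weight [l] is fixed. *)
Lemma le_atom_of_mix_fixed a b z : a != b ->
  (forall y, y != z -> c a z - c b z < c a y - c b y) ->
  (forall l nu, 0 < l < 1 -> l != 2^-1 -> is_mix l a b nu -> Phi nu = nu) ->
  forall mu, pr mu [set z] <= pr (Phi mu) [set z].
Proof.
move=> ab zmin fixed mu; have mz := measurable_point z.
(* Mass 1 is treated apart because [mix_detect] requires mass below 1. *)
have [mz1|mz1] := eqVneq (pr mu [set z]) 1.
  by rewrite (eq_wdirac p1 diam mz1) Phid.
have {}mz1 : pr mu [set z] < 1 by rewrite lt_neqAle mz1 pr_le1.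
have m0 := pr_ge0 (Phi mu) [set z].
rewrite leNgt; apply/negP; set m' := pr (Phi mu) _ in m0 *; set m := pr mu _ in mz1 *.
move=> lt.
(* The midpoint serves unless it is 1/2, a weight for which nothing is assumed fixed; then a quarter
   point is taken. *)
have [l [lm ml l2]] : exists l, [/\ m' < l, l < m & l != 2^-1].
  have [E|E] := eqVneq ((m + m') / 2) 2^-1; last first.
    by exists ((m + m') / 2); split=> //; lra.
  exists ((m + 3 * m') / 4); split; [lra|lra|].
  by apply/eqP => E'; move: lt; lra.
have l01 : 0 < l < 1 by apply/andP; split; lra.
have l01' : 0 <= l <= 1 by apply/andP; split; lra.
have [nu nuE] := mix_exists p1 diam a b l01'.
have E : wdist mu nu = wdist (Phi mu) nu by rewrite -{2}(fixed _ _ l01 l2 nuE) PhiI.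
suff : l <= m' by lra.
apply: (mix_detect p1 diam tb ab nuE _ zmin _ E) => //.
- by case/andP: l01.
- by rewrite pot_fixing.
- exact: ltW.
Qed.

End dirac_fixing.

(** * Antipodal mixtures under the quadratic cost *)

Section quadratic_torus.
Context {R : realType} {n : nat}.
Local Notation X := (torus R n).
Local Notation p2 := (2 : R).
Hypothesis p1 : 1 <= p2.
Variable Phi : wasserstein X p2 -> wasserstein X p2.
Hypothesis PhiI : forall mu nu, wdist (Phi mu) (Phi nu) = wdist mu nu.
Hypothesis Phid : forall x, Phi (wdirac p1 torus_diamP x) = wdirac p1 torus_diamP x.
Implicit Types (x y z w : X) (i j k : 'I_n) (mu nu : wasserstein X p2) (l : R).

Local Notation c x y := (mdist x y `^ p2).
Local Notation e k x := (half_shift (pred1 k) x).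

Let diam := @torus_diamP R n.
Let tb := @torus_totally_bounded R n.

Let sqdistxx x : sqdist x x = 0.
Proof. by rewrite /sqdist big1// => k _; rewrite tcoordxx expr0n. Qed.

Let sqdist_sym x y : sqdist x y = sqdist y x.
Proof. by apply: eq_bigr => k _; rewrite tcoord_sym. Qed.

Let tcoord_shift b x k : tcoord x (half_shift b x) k = if b k then 2^-1 else 0.
Proof. by rewrite tcoord_sym tcoord_half_shift tcoordxx subr0. Qed.

Let sqdist_x_anti x : sqdist x (anti x) = n%:R / 4.
Proof. by rewrite sqdist_half_shift cardT size_enum_ord. Qed.

Let sqdist_e_x x k : sqdist (e k x) x = 4^-1.
Proof. by rewrite sqdist_half_shift1 sqdistxx tcoordxx add0r subr0. Qed.

Let sqdist_e_anti x k : sqdist (e k x) (anti x) = (n%:R - 1) / 4.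
Proof. by rewrite sqdist_half_shift1 sqdist_x_anti tcoord_shift /=; field. Qed.

Let sqdist_e_e x k j : sqdist (e k x) (e j x) = if k == j then 0 else 2^-1.
Proof.
rewrite sqdist_half_shift1 (sqdist_sym x) sqdist_e_x tcoord_shift /=.
by case: eqVneq => _; field.
Qed.

(** The images of [nu] and [om] keep their potentials, hence lie on the cube with known face
    probabilities, and [face_correlation] applies to them. Its lower bound is proved for [nu] and
    [om] themselves and carried over by the isometry. *)
Lemma antipodal_mix_faces l x nu i j : 0 < l < 2^-1 -> i != j ->
  is_mix l x (anti x) nu -> pr (Phi nu) (face x j `&` ~` face x i) = 0.
Proof.
move=> l02 ij nuE; have /andP[l0 l2] := l02.
have axx : x != anti x by rewrite eq_sym; exact: (@half_shift_neq _ _ predT x i).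
have eij : e j x != e i x.
  apply/eqP => E; have := sqdist_e_e x j i.
  by rewrite E sqdistxx eq_sym (negbTE ij); lra.
have l01 : 0 <= l <= 1 by apply/andP; split; lra.
have [om omE] := mix_exists p1 diam (e j x) (e i x) l01.
have potnu y : pot nu y = l * sqdist y x + (1 - l) * sqdist y (anti x).
  by rewrite (pot_mix p1 diam axx nuE) !sqdistE.
have potom y : pot om y = l * sqdist y (e j x) + (1 - l) * sqdist y (e i x).
  by rewrite (pot_mix p1 diam eij omE) !sqdistE.
have potP := pot_fixing tb PhiI Phid.
have nu1 : pr (Phi nu) (cube x) = 1.
  apply: pr_cube; rewrite !potP !potnu !sqdistxx (sqdist_sym (anti x)) sqdist_x_anti.
  by field.
have om1 : pr (Phi om) (cube x) = 1.
  apply: pr_cube; rewrite !potP !potom !(sqdist_sym x) !(sqdist_sym (anti x)).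
  by rewrite !sqdist_e_x !sqdist_e_anti; field.
have nuf k : pr (Phi nu) (face x k) = l.
  rewrite pr_face// !potP !potnu sqdistxx sqdist_x_anti sqdist_e_x sqdist_e_anti.
  by field.
have omf k : pr (Phi om) (face x k) =
    1 - l * (k == j)%:R - (1 - l) * (k == i)%:R.
  rewrite pr_face// !potP !potom !(sqdist_sym x) !sqdist_e_x !sqdist_e_e.
  by case: (k == j); case: (k == i) => /=; field.
apply: (face_correlation ij l02 nu1 om1 nuf).
- by rewrite omf eqxx (negbTE ij) mulr0 mulr1; ring.
- by move=> k /negbTE ki /negbTE kj; rewrite omf ki kj !mulr0 !subr0.
move=> pi cpi; apply: wdist_cost (esym (PhiI nu om)) _ cpi => // {}pi cpi.
(* The cost of moving a point to the nearer atom of [om]. Both atoms are equally far from [x], and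
   equally far from [anti x], so the integral is explicit. *)
pose u (z : borel X) := Num.min (c (e j x) (z : X)) (c (e i x) (z : X)).
have bu : bmeas u by apply: bmeas_min; exact: bmeas_cost.
have Iu : \int[nu]_z u z = (n%:R - 2) * (1 - l) / 4 + 4^-1.
  rewrite (Rint_mix axx nuE bu) /u !sqdistE !sqdist_e_x !sqdist_e_anti.
  by rewrite /Num.min !ltxx; field.
rewrite -Iu -(coupling_Rint1 cpi bu).
have mj := measurable_point (e j x); have mi := measurable_point (e i x).
pose S : set (borel (X * X)%type) := [set: borel X] `*` ([set e j x] `|` [set e i x]).
apply: (@le_Rint _ (borel (X * X)%type) R pi S).
- by apply: measurable_rectangle => //; exact: measurableU.
- rewrite (coupling_pr2 cpi); last exact: measurableU.
  exact: pr_mixU omE.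
- exact: bmeas1 bu.
- exact: bmeas_cost2.
move=> [z w] [_ wji]; rewrite /u -(cost_sym (w : X) z) ge_min.
by apply/orP; case: wji => /= ->; [left|right]; exact: lexx.
Qed.

(** Off finitely many null sets, either all coordinates agree with those of [x] or none does, so
    within the cube only [x] and [anti x] remain. The potentials then determine the weights. *)
Lemma antipodal_mix_fixed_lt l x nu : (0 < n)%N -> 0 < l < 2^-1 ->
  is_mix l x (anti x) nu -> Phi nu = nu.
Proof.
move=> n0 l02 nuE; pose i0 := Ordinal n0.
have axx : x != anti x by rewrite eq_sym; exact: (@half_shift_neq _ _ predT x i0).
have /andP[l0 l2] := l02.
have potP := pot_fixing tb PhiI Phid.
have nu1 : pr (Phi nu) (cube x) = 1.
  apply: pr_cube; rewrite !potP !(pot_mix p1 diam axx nuE) !sqdistE.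
  by rewrite !sqdistxx (sqdist_sym (anti x)) sqdist_x_anti; field.
apply: (eq_mix_of_pot p1 diam axx nuE); last exact: potP.
have mx := measurable_point x; have ma := measurable_point (anti x).
have mxa : measurable ([set x] `|` [set anti x] : set (borel X)) by exact: measurableU.
pose F (ij : 'I_n * 'I_n) : set (borel X) :=
  if ij.1 == ij.2 then set0 else face x ij.2 `&` ~` face x ij.1.
have mF ij : measurable (F ij).
  rewrite /F; case: ifP => // _; apply: measurableI; first exact: measurable_face.
  by apply: measurableC; exact: measurable_face.
have F0 ij : pr (Phi nu) (F ij) = 0.
  rewrite /F; case: ifPn => [_|ij12]; first by rewrite pr0.
  exact: (antipodal_mix_faces l02 ij12 nuE).
(* The finite family is listed as a sequence; beyond its end the default pair [(i0, i0)] gives the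
   empty set. *)
pose G m := F (nth (i0, i0) (enum (('I_n * 'I_n)%type : finType)) m).
have mG : measurable (\bigcup_m G m).
  by apply: bigcupT_measurable => m; exact: mF.
have G0 : pr (Phi nu) (\bigcup_m G m) = 0.
  by apply: pr_bigcup0 => m; [exact: mF|exact: F0].
have mcu := measurable_cube x.
rewrite -(prI1 mxa mcu nu1); apply/eqP; rewrite eq_le pr_le1/=; last exact: measurableI.
apply: (@le_trans _ _ (pr (Phi nu) (cube x))); first by rewrite nu1.
rewrite (pr_split _ mcu mG) [X in X + _ <= _](_ : _ = 0) ?add0r; last first.
  apply/eqP; rewrite eq_le pr_ge0 andbT -G0; apply: le_pr => //; exact: measurableI.
apply: le_pr; [by apply: measurableI => //; exact: measurableC|exact: measurableI|].
move=> z [zc zG]; split => //.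
have zF i j : i != j -> tcoord x z j = 0 -> tcoord x z i = 0.
  move=> ij zj; apply: contrapT => zi; apply: zG.
  exists (index (i, j) (enum (('I_n * 'I_n)%type : finType))) => //.
  by rewrite /G nth_index ?mem_enum// /F /= (negbTE ij).
have [z0|z0] := pselect (tcoord x z i0 = 0).
  left; apply: eq_torus => k.
  by have [->//|ki] := eqVneq k i0; exact: zF ki z0.
right; apply: eq_half_shift => k /=.
case: (zc k) => // zk; case: z0.
by have [<-//|ki] := eqVneq k i0; apply: zF zk; rewrite eq_sym.
Qed.

Lemma antipodal_mix_fixed l x nu : (0 < n)%N -> 0 < l < 1 -> l != 2^-1 ->
  is_mix l x (anti x) nu -> Phi nu = nu.
Proof.
move=> n0 /andP[l0 l1]; rewrite neq_lt => /orP[l2|l2] nuE.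
  by apply: antipodal_mix_fixed_lt nuE => //; apply/andP.
(* For [l > 1/2] the measure is a mixture based at [anti x], whose antipode is [x], with weight
   [1 - l < 1/2]. *)
have := mix_swap nuE; rewrite -{2}(half_shiftK predT x) => nuE'.
by apply: antipodal_mix_fixed_lt nuE' => //; apply/andP; split; lra.
Qed.

End quadratic_torus.

(** * Strict minima and mixtures determined by their potentials *)

Section torus_mixes.
Context {R : realType} {n : nat} {p : R}.
Local Notation X := (torus R n).
Hypothesis p1 : 1 <= p.
Implicit Types (x y z : X) (mu nu : wasserstein X p) (l : R).

Local Notation c x y := (mdist x y `^ p).
Let diam := @torus_diamP R n.

Let p0 : 0 < p. Proof. exact: lt_le_trans p1. Qed.
Let q0 : 0 < p / 2. Proof. by rewrite divr_gt0. Qed.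

(** The point [x] is the only zero of its own cost, and the cost from [anti x] is largest there. *)
Lemma anti_detects x z : z != x ->
  c x x - c (anti x) x < c x z - c (anti x) z.
Proof.
move=> zx; rewrite costxx// sub0r; apply: (@lt_le_trans _ _ (c x z - c (anti x) x)).
  by rewrite ltrDr powR_gt0// mdist_gt0 eq_sym.
by rewrite lerD2l lerN2 ler_cost// (metric_sym (anti x) x) mdist_anti diam.
Qed.

(** With the exponent p/2 > 1, strict superadditivity applies to the squared distances to [x] and
    [anti x], whose sum is at most n/4. So the sum of the two costs is below its value at [x] and
    [anti x] everywhere else. *)
Lemma antipodal_mix_of_pot l x mu nu : (0 < n)%N -> 2 < p ->
  is_mix l x (anti x) nu -> (forall y, pot mu y = pot nu y) -> mu = nu.
Proof.
move=> n0 p2 nuE munu.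
have axx : x != anti x.
  by rewrite eq_sym; exact: (@half_shift_neq _ _ predT x (Ordinal n0)).
have q1 : 1 < p / 2 by rewrite ltr_pdivlMr// mul1r.
apply: (mix_of_pot p1 diam axx nuE (a' := x) (b' := anti x) (M := c x (anti x))) => //.
- move=> z zx za; rewrite !powR_mdist.
  apply: lt_le_trans (powR_strict_superadd q1 _ _) _; rewrite ?sqdist_gt0//.
  rewrite ge0_ler_powR ?nnegrE ?addr_ge0 ?sqdist_ge0// ?(ltW q0)//.
  rewrite sqdist_add_anti sqdist_half_shift cardT size_enum_ord gerBl.
  by apply: sumr_ge0 => k _; rewrite !mulr_ge0 ?tcoord_ge0 ?subr_ge0 ?tcoord_le.
- by rewrite costxx// add0r cost_sym.
- by rewrite costxx// addr0.
Qed.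

(** The half-shift raises the squared distance by at most 1/4, the amount by which it raises it at
    [x] itself. Strict subadditivity of the power p/2 < 1 makes the comparison strict. *)
Lemma coordinate_detects x z k : p < 2 -> z != x ->
  c x x - c (half_shift (pred1 k) x) x <
  c x z - c (half_shift (pred1 k) x) z.
Proof.
move=> p2 zx; have q1 : p / 2 < 1 by rewrite ltr_pdivrMr// mul1r.
rewrite costxx// sub0r ltrBrDl -ltrBrDr opprK addrC.
rewrite !powR_mdist !sqdist_half_shift1 tcoordxx subr0.
have -> : sqdist x x = 0 by rewrite /sqdist big1// => m _; rewrite tcoordxx expr0n.
rewrite add0r.
have Q0 : 0 < sqdist x z by rewrite sqdist_gt0.
rewrite [ltRHS]addrC.
apply: le_lt_trans (powR_strict_subadd q1 Q0 _); last by rewrite invr_gt0.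
have t0 := tcoord_ge0 x z k.
rewrite ge0_ler_powR ?nnegrE ?(ltW q0)//.
- by rewrite -sqdist_half_shift1 sqdist_ge0.
- by rewrite addr_ge0 ?sqdist_ge0.
- by rewrite gerBl.
Qed.

(** The auxiliary points are [anti x] and [b'], which differ only in coordinate [k]. The squared
    distances to them are (1/2 - s)^2 + r and s^2 + r, where s is the distance to [x] in coordinate
    [k]. Bounding each power by its chord as in [powR_half_convex] gives two bounds with a constant
    sum, the common value at [x] and at its half-shift. *)
Lemma coordinate_mix_of_pot l x k mu nu : (1 < n)%N ->
  is_mix l x (half_shift (pred1 k) x) nu ->
  (forall y, pot mu y = pot nu y) -> mu = nu.
Proof.
move=> n1 nuE munu.
have ekx : x != half_shift (pred1 k) x.
  by rewrite eq_sym; apply: (@half_shift_neq _ _ _ x k); rewrite /= eqxx.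
(* This is the maximum of [r], attained when the other coordinates agree with those of [x]; it is
   positive because there are at least two coordinates. *)
pose C : R := (n%:R - 1) / 4.
have C0 : 0 < C by rewrite divr_gt0// subr_gt0 ltr1n.
pose b' := half_shift (predC1 k) x.
pose r z := \sum_(m | m != k) (2^-1 - tcoord x z m) ^+ 2.
have Qa z : sqdist (anti x) z = (2^-1 - tcoord x z k) ^+ 2 + r z.
  by rewrite sqdist_anti (bigD1 k).
have Qb z : sqdist b' z = tcoord x z k ^+ 2 + r z.
  rewrite /sqdist (bigD1 k)//= tcoord_half_shift /= eqxx /=; congr (_ + _).
  by apply: eq_bigr => m mk; rewrite tcoord_half_shift /= mk.
have rC z : C - r z = \sum_(m | m != k) tcoord x z m * (1 - tcoord x z m).
  have -> : C = \sum_(m | m != k) 4^-1.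
    have : \sum_(m < n) 4^-1 = n%:R / 4 :> R by rewrite sumr_const card_ord mulr_natl.
    by rewrite (bigD1 k)//= /C mulrBl mul1r => <-; ring.
  by rewrite -sumrB; apply: eq_bigr => m _; field.
have h0 z m : 0 <= tcoord x z m * (1 - tcoord x z m).
  rewrite mulr_ge0 ?tcoord_ge0// subr_ge0 (le_trans (tcoord_le x z m))//.
  by rewrite invf_le1// ler1n.
have rle z : r z <= C by rewrite -subr_ge0 rC sumr_ge0.
have r0 z : 0 <= r z by apply: sumr_ge0 => m _; exact: sqr_ge0.
have C4 : C + 4^-1 = 4^-1 + C by rewrite addrC.
have rx : r x = C.
  by apply/eqP; rewrite eq_sym -subr_eq0 rC big1// => m _; rewrite tcoordxx mul0r.
have tek m : tcoord x (half_shift (pred1 k) x) m = if m == k then 2^-1 else 0.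
  by rewrite tcoord_sym tcoord_half_shift /= tcoordxx subr0.
have re : r (half_shift (pred1 k) x) = C.
  apply/eqP; rewrite eq_sym -subr_eq0 rC big1// => m /negbTE mk.
  by rewrite tek mk mul0r.
have half2 : (2^-1 : R) ^+ 2 = 4^-1 by field.
apply: (mix_of_pot p1 diam ekx nuE (a' := anti x) (b' := b')
  (M := (4^-1 + C) `^ (p / 2) + C `^ (p / 2))) => //; last 2 first.
- by rewrite !powR_mdist Qa Qb rx tcoordxx subr0 half2 expr0n /= add0r.
- rewrite !powR_mdist Qa Qb re tek eqxx subrr half2 expr0n /= add0r.
  by rewrite addrC.
move=> z zx ze; rewrite !powR_mdist Qa Qb.
set s := tcoord x z k.
have s0 : 0 <= s by exact: tcoord_ge0.
have s1 : s <= 2^-1 by exact: tcoord_le.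
have mono t u v : 0 <= u -> u <= v ->
    (t ^+ 2 + u) `^ (p / 2) <= (t ^+ 2 + v) `^ (p / 2).
  move=> u0 uv; rewrite ge0_ler_powR ?nnegrE ?addr_ge0 ?sqr_ge0// ?(ltW q0)//.
    exact: le_trans uv.
  by rewrite lerD2l.
have smono t u v : 0 <= u -> u < v ->
    (t ^+ 2 + u) `^ (p / 2) < (t ^+ 2 + v) `^ (p / 2).
  move=> u0 uv; rewrite gt0_ltr_powR ?nnegrE ?addr_ge0 ?sqr_ge0//.
    exact: le_trans (ltW uv).
  by rewrite ltrD2l.
have wconv t : 0 <= t <= 2^-1 -> (t ^+ 2 + C) `^ (p / 2) <=
    (1 - 2 * t) * C `^ (p / 2) + 2 * t * (C + 4^-1) `^ (p / 2).
  move=> /andP[]; rewrite le_eqVlt => /predU1P[<- _|t0].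
    by rewrite expr0n /= add0r mulr0 subr0 mul1r mul0r addr0.
  rewrite le_eqVlt => /predU1P[->|t1].
    by rewrite half2 mulfV// subrr mul0r mul1r add0r addrC.
  by apply/ltW/powR_half_convex => //; rewrite t0.
have hs' : 0 <= 2^-1 - s <= 2^-1 by apply/andP; split; lra.
have hs : 0 <= s <= 2^-1 by apply/andP; split.
have sum t (A B : R) : (1 - 2 * (2^-1 - t)) * A + 2 * (2^-1 - t) * B +
    ((1 - 2 * t) * A + 2 * t * B) = B + A by field.
rewrite -C4 -(sum s (C `^ (p / 2)) ((C + 4^-1) `^ (p / 2))).
(* If [r z < C], strictness comes from monotonicity in [r]. If [r z = C], then [z] differs from [x]
   only in coordinate [k], and being neither [x] nor its half-shift it has 0 < s < 1/2, where the
   chord bound is strict. *)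
have := rle z; rewrite le_eqVlt => /predU1P[rE|rlt]; last first.
  apply: ltr_leD; last by apply: le_trans (wconv _ hs); apply: mono.
  by apply: lt_le_trans (wconv _ hs'); exact: smono.
have tz m : m != k -> tcoord x z m = 0.
  move=> mk; have /eqP := rC z; rewrite rE subrr eq_sym psumr_eq0//.
  move=> /allP/(_ m); rewrite mem_index_enum mk /= => /(_ isT).
  rewrite mulf_eq0 => /orP[/eqP//|]; rewrite subr_eq0 => /eqP h.
  by have := tcoord_le x z m; rewrite -h; lra.
have sn0 : s != 0.
  apply: contraNN zx => /eqP sE; apply/eqP; apply: eq_torus => m.
  by have [->//|mk] := eqVneq m k; exact: tz.
have sn1 : s != 2^-1.
  apply: contraNN ze => /eqP sE; apply/eqP; apply: eq_half_shift => m /=.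
  by have [->//|mk] := eqVneq m k; exact: tz.
have s01 : 0 < s < 2^-1 by rewrite !lt_neqAle s0 s1 sn1 eq_sym sn0.
rewrite rE; apply: ltr_leD; last exact: wconv.
apply: powR_half_convex => //; move: s01 => /andP[? ?]; apply/andP; split; lra.
Qed.

End torus_mixes.

(** * Rigidity in the three ranges of the exponent *)

Theorem theorem3p2 (R : realType) (n : nat) (p : R) :
  (2 <= n)%N -> 1 <= p -> isometrically_rigid (torus R n) p.
Proof.
move=> n2 p1; have n0 : (0 < n)%N by exact: ltnW.
pose i0 := Ordinal n0.
have tb := @torus_totally_bounded R n.
apply: (rigid_of_dirac_fixing (p1 := p1) (diam := @torus_diamP R n) tb
  (anti := anti)).
- exact: mdist_anti.
- by move=> x y; exact: mdist_antiP.
move=> Phi PhiI Phid.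
apply: (isometry_id_of_atoms p1 (@torus_diamP R n) tb PhiI) => mu x.
have potP := pot_fixing tb PhiI Phid.
have axx : x != anti x by rewrite eq_sym; exact: (@half_shift_neq _ _ predT x i0).
have [p2|p2|p2] := ltgtP p 2.
- apply: (le_atom_of_mix_fixed tb PhiI Phid (a := x) (b := half_shift (pred1 i0) x)).
  + by rewrite eq_sym; apply: (@half_shift_neq _ _ _ x i0); rewrite /= eqxx.
  + by move=> z; exact: coordinate_detects.
  + by move=> l nu _ _ nuE; apply: (coordinate_mix_of_pot p1 n2 nuE).
- apply: (le_atom_of_mix_fixed tb PhiI Phid axx).
  + by move=> z; exact: anti_detects.
  + by move=> l nu _ _ nuE; apply: (antipodal_mix_of_pot p1 n0 p2 nuE).
- apply: (le_atom_of_mix_fixed tb PhiI Phid axx).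
  + by move=> z; exact: anti_detects.
  + subst p => l nu l01 l2 nuE; exact: (antipodal_mix_fixed PhiI Phid n0 l01 l2 nuE).
Qed.
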